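(* Let $\mathbb G$ be a step 2 Carnot group with CC distance $d$ and $d_0=d(\cdot,0)$. Let $g:\mathbb G\to\mathbb R$ be lower semicontinuous with $g(p)\ge -C(1+d_0(p))$ for all $p\in\mathbb G$ for some $C>0$. Define $$u(t,p)=\inf_{q\in\mathbb G}\Big\{g(q)+\frac{d(p,q)^2}{2t}\Big\},\qquad t>0,\ p\in\mathbb G$$ (the Hopf–Lax solution of $u_t+\tfrac12|\nabla_Hu|^2=0$, $u(0,\cdot)=g$). Then for every $t>0$, $u(t,\cdot)$ is h-semiconcave in $\mathbb G$.
   Context: A step 2 Carnot group is identified with $\mathbb R^n=\mathbb R^m\times\mathbb R^{n_2}$ with law $p\cdot q=(p^{(1)}+q^{(1)},p^{(2)}+q^{(2)}+\mathcal B(p^{(1)},q^{(1)}))$, $\mathcal B$ skew-symmetric bilinear, identity $0$, $p^{-1}=-p$; $X_1,\dots,X_m$ are the left-invariant fields equal to $\partial/\partial p_i$ at $0$, $\nabla_Hu=(X_1u,\dots,X_mu)$; CC distance $d(p,q)$ = infimum of $\int_0^1|u|$ over absolutely continuous curves from $p$ to $q$ with $\dot\gamma=\sum u_iX_i(\gamma)$ a.e. $\mathcal H_0=\mathbb R^m\times\{0\}$, $|\cdot|$ Euclidean norm. A lower semicontinuous function $v$ on $\mathbb G$ is h-semiconcave if there is $C'\ge0$ with $v(p\cdot h)+v(p\cdot h^{-1})-2v(p)\le C'|h|^2$ for all $p\in\mathbb G$, $h\in\mathcal H_0$. *)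

(* Defs.v *)
From HB Require Import structures.
From mathcomp Require Import all_boot all_order all_algebra.
From mathcomp Require Import all_classical all_reals all_analysis.
Set Implicit Arguments. Unset Strict Implicit. Unset Printing Implicit Defensive.
Import Order.TTheory GRing.Theory Num.Theory.
Import numFieldNormedType.Exports.
Local Open Scope classical_set_scope.
Local Open Scope ring_scope.

Section Carnot.
Variable R : realType.

Definition enorm (k : nat) (x : 'rV[R]_k) : R :=
  Num.sqrt (\sum_(i < k) x 0 i ^+ 2).

(* A skew-symmetric bilinear map B : R^m x R^m -> R^n2 is encoded by
   n2 skew-symmetric m x m matrices b k : B(x,y)_k = x * (b k) * y^T. *)
Definition skew_family (m n2 : nat) (b : 'I_n2 -> 'M[R]_m) : Prop :=
  forall k, (b k)^T = - b k.

Definition Bform (m n2 : nat) (b : 'I_n2 -> 'M[R]_m) (x y : 'rV[R]_m) : 'rV[R]_n2 :=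
  \row_k (x *m b k *m y^T) 0 0.

(* Step 2 Carnot: the second layer is generated by brackets of the first,
   i.e. the vectors B(e_i,e_j) span R^n2 (and n2 >= 1). *)
Definition step2_generating (m n2 : nat) (b : 'I_n2 -> 'M[R]_m) : Prop :=
  (0 < n2)%N /\
  forall v : 'rV[R]_n2, exists c : 'I_m -> 'I_m -> R,
    v = \sum_(i < m) \sum_(j < m) c i j *: Bform b (delta_mx 0 i) (delta_mx 0 j).

Definition pt (m n2 : nat) := ('rV[R]_m * 'rV[R]_n2)%type.

Definition gmul (m n2 : nat) (b : 'I_n2 -> 'M[R]_m) (p q : pt m n2) : pt m n2 :=
  (p.1 + q.1, p.2 + q.2 + Bform b p.1 q.1).
Definition ginv (m n2 : nat) (p : pt m n2) : pt m n2 := (- p.1, - p.2).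

Definition vint (k : nat) (f : R -> 'rV[R]_k) (a c : R) : 'rV[R]_k :=
  \row_i Rintegral lebesgue_measure `[a, c] (fun s => f s 0 i).

Definition vintegrable (k : nat) (f : R -> 'rV[R]_k) : Prop :=
  forall i, lebesgue_measure.-integrable `[0, 1] (EFin \o (fun s => f s 0 i)).

(* u : [0,1] -> R^m is the control of an absolutely continuous horizontal
   curve gamma from p to q: gamma' = sum_i u_i X_i(gamma) a.e., where
   X_i(x) = (e_i, B(x1, e_i)); written in integral form. *)
Definition horizontal_control (m n2 : nat) (b : 'I_n2 -> 'M[R]_m)
    (p q : pt m n2) (u : R -> 'rV[R]_m) : Prop :=
  let g1 := fun t => p.1 + vint u 0 t in
  vintegrable u /\
  vintegrable (fun s => Bform b (g1 s) (u s)) /\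
  q.1 = g1 1 /\
  q.2 = p.2 + vint (fun s => Bform b (g1 s) (u s)) 0 1.

Definition ccdist (m n2 : nat) (b : 'I_n2 -> 'M[R]_m) (p q : pt m n2) : R :=
  inf [set c | exists u, horizontal_control b p q u /\
                 c = Rintegral lebesgue_measure `[0, 1] (fun s => enorm (u s))].

Definition ptnorm (m n2 : nat) (p : pt m n2) : R :=
  Num.sqrt (enorm p.1 ^+ 2 + enorm p.2 ^+ 2).

Definition lsc (m n2 : nat) (v : pt m n2 -> R) : Prop :=
  forall p (e : R), 0 < e -> exists2 delta : R, 0 < delta &
    forall q, ptnorm (q.1 - p.1, q.2 - p.2) < delta -> v p - e < v q.

Definition hsemiconcave (m n2 : nat) (b : 'I_n2 -> 'M[R]_m) (v : pt m n2 -> R) : Prop :=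
  lsc v /\ exists C' : R, 0 <= C' /\
    forall (p : pt m n2) (h1 : 'rV[R]_m),
      let h : pt m n2 := (h1, 0) in
      v (gmul b p h) + v (gmul b p (ginv h)) - 2 * v p <= C' * enorm h1 ^+ 2.

Definition hopf_lax (m n2 : nat) (b : 'I_n2 -> 'M[R]_m) (g : pt m n2 -> R)
    (t : R) (p : pt m n2) : R :=
  inf [set g q + ccdist b p q ^+ 2 / (2 * t) | q in [set: pt m n2]].

End Carnot.

(* Main.v *)
Require Import Defs.
From HB Require Import structures.
From mathcomp Require Import all_boot all_order all_algebra.
From mathcomp Require Import all_classical all_reals all_analysis.
From mathcomp Require Import perm measurable_realfun.
From mathcomp Require Import ring lra.
Import Order.TTheory GRing.Theory Num.Theory.
Import numFieldNormedType.Exports.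
Local Open Scope classical_set_scope.
Local Open Scope ring_scope.
Set Implicit Arguments. Unset Strict Implicit. Unset Printing Implicit Defensive.

(** The heart of the matter is the horizontal semiconcavity of the squared
    distance, d(ph,q)^2 + d(ph^-1,q)^2 <= 2 d(p,q)^2 + C|h|^2 with C depending on m only;
    it passes to the infimum over q.

    An almost shortest curve from p to q is replaced by a polygon with N steps f_i
    minimizing the energy N sum |f_i|^2 plus N times the squared second layer error.
    The penalization avoids Lagrange multipliers, hence abnormal curves, and the
    critical point equation reads f_(i+1)(1 + A) = f_i(1 - A) with A skew, so that
    f_i = f_0 Q^i with Q orthogonal. If the weights psi_i sum to 1 and annihilate
    the vertices of the polygon, the steps f_i -+ psi_i h lead from p h^(+-1) to q up
    to an error tending to 0 with N, and by the parallelogram law the two energies add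
    up to twice the original one plus 2N sum psi_i^2 |h|^2. Weights with
    N sum psi_i^2 bounded independently of N and Q come from the characteristic
    polynomials of the powers of Q, whose coefficients are bounded. *)

(** * Euclidean norm and group law *)

Section Euclidean.
Variables (R : realType) (k : nat).
Implicit Types (x y z : 'rV[R]_k) (c : R).

(** Shifting the steps by [psi_i h] repairs the first layer as soon as the weights sum to 1, but in
    general it moves the second layer by a term of first order in [h]. A gap [y] there costs about
    [|y|^(1/2)] in distance, far more than [|h|^2] for small [h], so this term has to be cancelled
    and not estimated; the condition on the vertices does that. Being linear, it lets the same
    weights serve [h] and [-h], and the second order term vanishes because all shifts are parallel
    and [B] is skew. What remains is a sum over the steps in place of the vertices, which is small
    for large [N].

    Orthogonality makes the weights uniform in the polygon: it bounds the coefficients of the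
    annihilating polynomials and gives them a constant term of modulus 1, by which one may
    divide. *)

Definition dot x y : R := \sum_i x 0 i * y 0 i.

Lemma dotC x y : dot x y = dot y x.
Proof. by apply: eq_bigr => i _; rewrite mulrC. Qed.

Lemma dotDl x y z : dot (x + y) z = dot x z + dot y z.
Proof. by rewrite -big_split; apply: eq_bigr => i _; rewrite mxE mulrDl. Qed.

Lemma dotZl c x z : dot (c *: x) z = c * dot x z.
Proof. by rewrite /dot big_distrr; apply: eq_bigr => i _; rewrite mxE -mulrA. Qed.

Lemma dotDr x y z : dot x (y + z) = dot x y + dot x z.
Proof. by rewrite !(dotC x) dotDl. Qed.

Lemma dotZr c x z : dot x (c *: z) = c * dot x z.
Proof. by rewrite !(dotC x) dotZl. Qed.

Lemma dotNl x y : dot (- x) y = - dot x y.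
Proof. by rewrite -scaleN1r dotZl mulN1r. Qed.

Lemma dotNr x y : dot x (- y) = - dot x y.
Proof. by rewrite !(dotC x) dotNl. Qed.

Lemma dot_mul_tr x y : dot x y = (x *m y^T) 0 0.
Proof. by rewrite mxE; apply: eq_bigr => i _; rewrite mxE. Qed.

Lemma dot_eq0 x : (forall y, dot x y = 0) -> x = 0.
Proof.
move=> x0; apply/rowP => i; rewrite mxE -(x0 (delta_mx 0 i)) /dot.
rewrite (bigD1 i) //= mxE !eqxx mulr1 big1 ?addr0// => j /negPf ji.
by rewrite mxE ji andbF mulr0.
Qed.

Lemma enorm_sqr x : enorm x ^+ 2 = dot x x.
Proof.
rewrite sqr_sqrtr; last by apply: sumr_ge0 => i _; rewrite sqr_ge0.
by apply: eq_bigr => i _; rewrite expr2.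
Qed.

Lemma enorm_ge0 x : 0 <= enorm x.
Proof. exact: sqrtr_ge0. Qed.

Lemma enorm_sqrD x y : enorm (x + y) ^+ 2 = enorm x ^+ 2 + 2 * dot x y + enorm y ^+ 2.
Proof. by rewrite !enorm_sqr dotDl !dotDr (dotC y x); ring. Qed.

Lemma enormZ c x : enorm (c *: x) = `|c| * enorm x.
Proof.
apply/eqP; rewrite -(@eqrXn2 _ 2) ?mulr_ge0 ?enorm_ge0//.
by rewrite exprMn !enorm_sqr dotZl dotZr mulrA -expr2 real_normK ?num_real.
Qed.

Lemma enormN x : enorm (- x) = enorm x.
Proof. by rewrite -scaleN1r enormZ normrN1 mul1r. Qed.

Lemma enorm0 : enorm (0 : 'rV[R]_k) = 0.
Proof. by rewrite -(scale0r 0) enormZ normr0 mul0r. Qed.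

Lemma enorm0_eq0 x : enorm x = 0 -> x = 0.
Proof.
move=> x0; have := enorm_sqr x; rewrite x0 expr0n /= => /esym/eqP.
rewrite psumr_eq0; last by move=> i _; rewrite -expr2 sqr_ge0.
move=> /allP h; apply/rowP => i; rewrite mxE.
by have := h i (mem_index_enum i); rewrite mulf_eq0 orbb => /eqP.
Qed.

Lemma cauchy_schwarz x y : dot x y <= enorm x * enorm y.
Proof.
have [x0|x0] := eqVneq (enorm x) 0.
  by rewrite x0 mul0r (enorm0_eq0 x0) -(scale0r 0) dotZl mul0r.
have [y0|y0] := eqVneq (enorm y) 0.
  by rewrite y0 mulr0 (enorm0_eq0 y0) -(scale0r 0) dotZr mul0r.
have gx : 0 < enorm x by rewrite lt_neqAle eq_sym x0 enorm_ge0.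
have gy : 0 < enorm y by rewrite lt_neqAle eq_sym y0 enorm_ge0.
have := sqr_ge0 (enorm (enorm y *: x - enorm x *: y)).
rewrite enorm_sqrD enormN !enormZ dotNr dotZl dotZr !ger0_norm ?enorm_ge0//.
set a := enorm x; set c := enorm y => h.
have {}h : 0 <= 2 * (a * c) * (a * c - dot x y) by lra.
by rewrite pmulr_rge0 ?subr_ge0 // in h; rewrite !mulr_gt0.
Qed.

Lemma normr_dot x y : `|dot x y| <= enorm x * enorm y.
Proof.
rewrite ler_norml cauchy_schwarz andbT lerNl -dotNl.
by rewrite (le_trans (cauchy_schwarz _ _))// enormN.
Qed.

Lemma ler_enormD x y : enorm (x + y) <= enorm x + enorm y.
Proof.
rewrite -(@ler_pXn2r _ 2) ?nnegrE ?addr_ge0 ?enorm_ge0//.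
by rewrite enorm_sqrD sqrrD; have := cauchy_schwarz x y; lra.
Qed.

Lemma ler_enorm_sum (I : Type) (r : seq I) (P : pred I) (F : I -> 'rV[R]_k) :
  enorm (\sum_(i <- r | P i) F i) <= \sum_(i <- r | P i) enorm (F i).
Proof.
elim/big_ind2 : _ => [|a p c q h1 h2|//]; first by rewrite enorm0.
by rewrite (le_trans (ler_enormD _ _))// lerD.
Qed.

Lemma ler_coord_enorm x i : `|x 0 i| <= enorm x.
Proof.
rewrite -(@ler_pXn2r _ 2) ?nnegrE ?enorm_ge0// real_normK ?num_real// enorm_sqr.
rewrite /dot (bigD1 i)//= -expr2 lerDl sumr_ge0// => j _.
by rewrite -expr2 sqr_ge0.
Qed.

Lemma ler_enorm_coord x : enorm x <= \sum_i `|x 0 i|.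
Proof.
rewrite -(@ler_pXn2r _ 2) ?nnegrE ?enorm_ge0 ?sumr_ge0// enorm_sqr expr2.
rewrite /dot big_distrl; apply: ler_sum => i _ /=.
rewrite -expr2 -real_normK ?num_real// expr2 ler_wpM2l//.
by rewrite (bigD1 i)//= lerDl sumr_ge0.
Qed.

End Euclidean.

Section Group.
Variables (R : realType) (m n2 : nat) (b : 'I_n2 -> 'M[R]_m).
Implicit Types (x y z : 'rV[R]_m) (c : R) (p q r : pt R m n2).

Lemma BformE x y i : Bform b x y 0 i = (x *m b i *m y^T) 0 0.
Proof. by rewrite mxE. Qed.

Lemma BformDl x y z : Bform b (x + y) z = Bform b x z + Bform b y z.
Proof. by apply/rowP => i; rewrite [RHS]mxE !BformE !mulmxDl mxE. Qed.

Lemma BformDr x y z : Bform b x (y + z) = Bform b x y + Bform b x z.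
Proof. by apply/rowP => i; rewrite [RHS]mxE !BformE linearD mulmxDr mxE. Qed.

Lemma BformZl c x z : Bform b (c *: x) z = c *: Bform b x z.
Proof. by apply/rowP => i; rewrite [RHS]mxE !BformE -!scalemxAl mxE. Qed.

Lemma BformZr c x z : Bform b x (c *: z) = c *: Bform b x z.
Proof. by apply/rowP => i; rewrite [RHS]mxE !BformE linearZ /= -scalemxAr mxE. Qed.

Lemma BformNl x y : Bform b (- x) y = - Bform b x y.
Proof. by rewrite -scaleN1r BformZl scaleN1r. Qed.

Lemma BformNr x y : Bform b x (- y) = - Bform b x y.
Proof. by rewrite -scaleN1r BformZr scaleN1r. Qed.

Lemma Bform0l y : Bform b 0 y = 0.
Proof. by rewrite -(scale0r 0) BformZl scale0r. Qed.

Lemma Bform0r y : Bform b y 0 = 0.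
Proof. by rewrite -(scale0r 0) BformZr scale0r. Qed.

Lemma Bform_suml (I : Type) (s : seq I) (P : pred I) (F : I -> 'rV[R]_m) y :
  Bform b (\sum_(i <- s | P i) F i) y = \sum_(i <- s | P i) Bform b (F i) y.
Proof.
by apply: (big_morph (Bform b ^~ y)) => [u v|]; [exact: BformDl|exact: Bform0l].
Qed.

Lemma Bform_sumr (I : Type) (s : seq I) (P : pred I) (F : I -> 'rV[R]_m) y :
  Bform b y (\sum_(i <- s | P i) F i) = \sum_(i <- s | P i) Bform b y (F i).
Proof.
by apply: (big_morph (Bform b y)) => [u v|]; [exact: BformDr|exact: Bform0r].
Qed.

Lemma Bform_coord x y k : Bform b x y 0 k = \sum_j \sum_i x 0 i * b k i j * y 0 j.
Proof.
rewrite mxE mxE; apply: eq_bigr => j _; rewrite !mxE big_distrl /=.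
by apply: eq_bigr.
Qed.

Lemma Bform_bounded : exists2 c : R, 0 <= c &
  forall x y, enorm (Bform b x y) <= c * (enorm x * enorm y).
Proof.
exists (\sum_k \sum_j \sum_i `|b k i j|).
  by do 3! (apply: sumr_ge0 => ? _).
move=> x y; rewrite (le_trans (ler_enorm_coord _))// big_distrl /=.
apply: ler_sum => k _; rewrite Bform_coord (le_trans (ler_norm_sum _ _ _))//.
rewrite big_distrl /=; apply: ler_sum => j _.
rewrite (le_trans (ler_norm_sum _ _ _))//.
rewrite big_distrl /=; apply: ler_sum => i _.
rewrite !normrM [`|x 0 i| * _]mulrC -mulrA ler_wpM2l//.
by rewrite ler_pM// ler_coord_enorm.
Qed.

Hypothesis hskew : skew_family b.

Lemma BformC x y : Bform b x y = - Bform b y x.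
Proof.
apply/rowP => k; rewrite [RHS]mxE !BformE.
have -> : (x *m b k *m y^T) 0 0 = (x *m b k *m y^T)^T 0 0 by rewrite [RHS]mxE.
by rewrite !trmx_mul trmxK hskew mulNmx mulmxN mulmxA mxE.
Qed.

Lemma Bformxx x : Bform b x x = 0.
Proof.
have h := BformC x x.
have {}h : 2%:R *: Bform b x x = 0 by rewrite scaler_nat mulr2n {1}h addNr.
by move/eqP: h; rewrite scaler_eq0 pnatr_eq0 /= => /eqP.
Qed.

Lemma gmulA p q r : gmul b p (gmul b q r) = gmul b (gmul b p q) r.
Proof.
rewrite /gmul /=; congr (_, _); first by rewrite addrA.
rewrite BformDr BformDl.
move: (Bform b _ _) (Bform b _ _) (Bform b _ _) => u v w.
by apply/rowP => i; rewrite !mxE; ring.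
Qed.

Lemma gmul0 p : gmul b p (0, 0) = p.
Proof. by case: p => p1 p2; rewrite /gmul /= Bform0r !addr0. Qed.

Lemma gmul0l p : gmul b (0, 0) p = p.
Proof. by case: p => p1 p2; rewrite /gmul /= Bform0l addr0 !add0r. Qed.

Lemma gmulV p : gmul b p (ginv p) = (0, 0).
Proof. by case: p => p1 p2; rewrite /gmul /ginv /= BformNr Bformxx oppr0 addr0 !subrr. Qed.

Lemma gmulK p q : gmul b p (gmul b (ginv p) q) = q.
Proof. by rewrite gmulA gmulV gmul0l. Qed.

(** By skewness [t -> p (t x, 0)] solves the horizontal equation with constant control [x], so a
    list of steps is a horizontal polygon of length [wlen]. *)
Definition walk p (s : seq 'rV[R]_m) := foldl (fun p x => gmul b p (x, 0)) p s.
Definition wlen (s : seq 'rV[R]_m) : R := \sum_(x <- s) enorm x.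

Lemma wlen_ge0 s : 0 <= wlen s.
Proof. by apply: sumr_ge0 => *; exact: enorm_ge0. Qed.

Lemma wlen_cat s1 s2 : wlen (s1 ++ s2) = wlen s1 + wlen s2.
Proof. by rewrite /wlen big_cat. Qed.

Lemma walk_cat p s1 s2 : walk p (s1 ++ s2) = walk (walk p s1) s2.
Proof. by rewrite /walk foldl_cat. Qed.

Lemma walk_rev s : exists2 s', wlen s' = wlen s & forall p, walk (walk p s) s' = p.
Proof.
elim: s => [|x s [s' l e]]; first by exists [::].
exists (s' ++ [:: - x]).
  by rewrite wlen_cat l /wlen !big_cons big_nil enormN addr0 addrC.
move=> p; rewrite walk_cat /= e -gmulA.
have -> : (- x, 0) = @ginv R m n2 (x, 0) by rewrite /ginv /= oppr0.
by rewrite gmulV gmul0.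
Qed.

Definition psum (f : nat -> 'rV[R]_m) N : 'rV[R]_m := \sum_(i < N) f i.
(* (psum f N, pB f f N) is the endpoint of the polygon from the identity with
   horizontal steps f 0, ..., f (N-1); pB f g is its polarization. *)
Definition pB (f g : nat -> 'rV[R]_m) N := \sum_(i < N) Bform b (psum f i) (g i).

Lemma walk_mkseq p f N : walk p (mkseq f N) = gmul b p (psum f N, pB f f N).
Proof.
elim: N => [|N IH]; first by rewrite /= /psum /pB !big_ord0 gmul0.
rewrite mkseqS -cats1 walk_cat /= IH -gmulA; congr gmul.
by rewrite /gmul /= addr0 /psum /pB !big_ord_recr.
Qed.

Lemma wlen_mkseq f N : wlen (mkseq f N) = \sum_(i < N) enorm (f i).
Proof. by rewrite /wlen big_map -[N in iota 0 N]subn0 big_mkord. Qed.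

End Group.

(** * Polygons and horizontal curves *)

Section IntegralCalculus.
Variable R : realType.
Notation mu := (@lebesgue_measure R).
Implicit Types (f g : R -> R) (a c t : R).

Definition integrable01 f := mu.-integrable `[0, 1] (EFin \o f).

Lemma integrable01_sub f a c : 0 <= a -> c <= 1 -> integrable01 f ->
  mu.-integrable `[a, c] (EFin \o f).
Proof.
move=> a0 c1; apply: integrableS => //; apply: subset_itv; rewrite bnd_simp//.
Qed.

Lemma integrable01D f g : integrable01 f -> integrable01 g ->
  integrable01 (fun s => f s + g s).
Proof.
move=> hf hg; rewrite /integrable01.
have -> : EFin \o (fun s => f s + g s) = ((EFin \o f) \+ (EFin \o g))%E by [].
exact: integrableD.
Qed.

Lemma integrable01Z k f : integrable01 f -> integrable01 (fun s => k * f s).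
Proof.
move=> hf; rewrite /integrable01.
have -> : EFin \o (fun s => k * f s) = (fun s => k%:E * (EFin \o f) s)%E by [].
exact: integrableZl.
Qed.

Lemma integrable01_sum (I : Type) (r : seq I) (F : I -> R -> R) :
  (forall i, integrable01 (F i)) -> integrable01 (fun s => \sum_(i <- r) F i s).
Proof.
move=> hF; rewrite /integrable01.
have -> : EFin \o (fun s => \sum_(i <- r) F i s) =
    (fun s => \sum_(i <- r) (EFin \o F i) s)%E.
  by apply/funext => s /=; rewrite sumEFin.
by apply: integrable_sum => // i _; exact: hF.
Qed.

Lemma integrable01_cst k : integrable01 (fun=> k).
Proof.
apply: measurable_bounded_integrable => //.
  by rewrite /= lebesgue_measure_itv /= lte_fin ltr01 ltey_eq.
by exists `|k|; split; rewrite ?num_real// => M kM s _ /=; exact: ltW.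
Qed.

Lemma measurable_integrable01 f : integrable01 f ->
  measurable_fun (`[0, 1]%classic : set (measurableTypeR R)) f.
Proof. by move=> /(measurable_int mu) /measurable_EFinP. Qed.

Lemma integrable01_le f g :
  measurable_fun (`[0, 1]%classic : set (measurableTypeR R)) f ->
  (forall s, `|f s| <= g s) -> integrable01 g -> integrable01 f.
Proof.
move=> mf fg; apply: le_integrable => //; first exact/measurable_EFinP.
by move=> s _ /=; rewrite lee_fin (le_trans (fg s))// ler_norm.
Qed.

Lemma Rintegral_chasles f a c t : 0 <= a -> a <= c -> c <= t -> t <= 1 ->
  integrable01 f ->
  Rintegral mu `[a, t] f = Rintegral mu `[a, c] f + Rintegral mu `[c, t] f.
Proof.
move=> a0 ac ct t1 hf.
have := @Rintegral_itvB _ f (BLeft a) (BRight t) c.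
move=> /(_ (integrable01_sub a0 t1 hf)); rewrite !bnd_simp => /(_ ac ct).
rewrite Rintegral_itv_obnd_cbnd; last first.
  apply: (integrableS _ _ _ (integrable01_sub (le_trans a0 ac) t1 hf)) => //.
  exact: subset_itv_oc_cc.
by move=> <-; rewrite addrC subrK.
Qed.

Lemma Rintegral_eq0 a c f : (forall s, a <= s <= c -> f s = 0) ->
  Rintegral mu `[a, c] f = 0.
Proof.
move=> f0; rewrite (@eq_Rintegral _ _ _ _ _ (fun=> 0)) ?Rintegral_cst ?mul0r//.
by move=> s; rewrite inE /= in_itv /= => /f0.
Qed.

Lemma integrable01_indic a c : integrable01 (\1_(`]a, c] : set R)).
Proof.
apply: integrableS (integrable_indic_itv a c false false) => //.
Qed.

Lemma Rintegral_indic01 a c : 0 <= a -> a <= c -> c <= 1 ->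
  Rintegral mu `[0, 1] (\1_(`]a, c] : set R)) = c - a.
Proof.
move=> a0 ac c1; rewrite /Rintegral integral_indic// setIidl; last first.
  by apply: subset_itv; rewrite bnd_simp.
rewrite /= lebesgue_measure_itv /= lte_fin; case: ltP => // ca.
by apply/eqP; rewrite eq_sym subr_eq0 eq_le ca ac.
Qed.

Lemma measurable_Rsqrt : measurable_fun [set: R] (@Num.sqrt R).
Proof. by apply: continuous_measurable_fun; exact: sqrt_continuous. Qed.

Section Vector.
Variable k : nat.
Implicit Types (u v : R -> 'rV[R]_k).

Lemma integrable01_enorm u : vintegrable u -> integrable01 (fun s => enorm (u s)).
Proof.
move=> hu; apply: (@integrable01_le _ (fun s => \sum_i `|u s 0 i|)).
- apply: measurableT_comp; first exact: measurable_Rsqrt.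
  apply: measurable_sum => i; apply: measurable_funX.
  exact: (measurable_integrable01 (hu i)).
- by move=> s; rewrite ger0_norm ?enorm_ge0 ?ler_enorm_coord.
- by apply: integrable01_sum => i; apply: integrable_norm (hu i).
Qed.

Lemma vintD u v a c : 0 <= a -> c <= 1 -> vintegrable u -> vintegrable v ->
  vint (fun s => u s + v s) a c = vint u a c + vint v a c.
Proof.
move=> a0 c1 hu hv; apply/rowP => i; rewrite !mxE.
rewrite -RintegralD//; [|exact: integrable01_sub (hu i)|exact: integrable01_sub (hv i)].
by apply: eq_Rintegral => s _; rewrite mxE.
Qed.

Lemma vintZ f (x : 'rV[R]_k) a c : 0 <= a -> c <= 1 -> integrable01 f ->
  vint (fun s => f s *: x) a c = Rintegral mu `[a, c] f *: x.
Proof.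
move=> a0 c1 hf; apply/rowP => i; rewrite !mxE.
rewrite -RintegralZr//; last exact: integrable01_sub hf.
by apply: eq_Rintegral => s _; rewrite mxE.
Qed.

Lemma vintegrableD u v : vintegrable u -> vintegrable v ->
  vintegrable (fun s => u s + v s).
Proof.
move=> hu hv i; have := integrable01D (hu i) (hv i).
by apply: eq_integrable => // s _ /=; rewrite mxE.
Qed.

Lemma vintegrableZ f (x : 'rV[R]_k) : integrable01 f ->
  vintegrable (fun s => f s *: x).
Proof.
move=> hf i; have := integrable01Z (x 0 i) hf.
by apply: eq_integrable => // s _ /=; rewrite mxE mulrC.
Qed.

Lemma vint_chasles u a c t : 0 <= a -> a <= c -> c <= t -> t <= 1 ->
  vintegrable u -> vint u a t = vint u a c + vint u c t.
Proof.
by move=> a0 ac ct t1 hu; apply/rowP => i; rewrite !mxE (Rintegral_chasles a0 ac ct t1 (hu i)).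
Qed.

Lemma vint_eq0 a c u : (forall s, a <= s <= c -> u s = 0) -> vint u a c = 0.
Proof.
by move=> u0; apply/rowP => i; rewrite !mxE Rintegral_eq0// => s /u0 ->; rewrite mxE.
Qed.

Lemma eq_vintegrable u v : (forall s, 0 <= s <= 1 -> u s = v s) ->
  vintegrable u -> vintegrable v.
Proof.
move=> uv hu i; apply: eq_integrable (hu i) => // s.
by rewrite inE /= in_itv /= => /uv ->.
Qed.

Lemma eq_vint u v a c : (forall s, a <= s <= c -> u s = v s) ->
  vint u a c = vint v a c.
Proof.
move=> uv; apply/rowP => i; rewrite !mxE; apply: eq_Rintegral => s.
by rewrite inE /= in_itv /= => /uv ->.
Qed.

(** Test against the integral [x] itself: [|x|^2] is the integral of [dot x (u s)], and
    Cauchy-Schwarz bounds the integrand. *)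
Lemma enorm_vint u a c : 0 <= a -> c <= 1 -> vintegrable u ->
  enorm (vint u a c) <= Rintegral mu `[a, c] (fun s => enorm (u s)).
Proof.
move=> a0 c1 hu; set x := vint u a c.
have hen := integrable01_enorm hu.
have [->|x0] := eqVneq (enorm x) 0.
  by apply: Rintegral_ge0 => s _; exact: enorm_ge0.
have gx : 0 < enorm x by rewrite lt_neqAle eq_sym x0 enorm_ge0.
rewrite -(ler_pM2l gx) -expr2 enorm_sqr -RintegralZl//; last exact: integrable01_sub.
have hd : integrable01 (fun s => dot x (u s)).
  by apply: integrable01_sum => i; apply: integrable01Z; exact: hu.
have -> : dot x x = Rintegral mu `[a, c] (fun s => dot x (u s)).
  rewrite /dot.
  have gen (r : seq 'I_k) : Rintegral mu `[a, c] (fun s => \sum_(i <- r) x 0 i * u s 0 i)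
     = \sum_(i <- r) x 0 i * x 0 i.
    elim: r => [|i r IH].
      by rewrite big_nil Rintegral_eq0// => s _; rewrite big_nil.
    rewrite big_cons -IH [in RHS]/x mxE -RintegralZl//; last first.
      exact: integrable01_sub (hu i).
    rewrite -RintegralD//.
    - by apply: eq_Rintegral => s _; rewrite big_cons -/x; congr (_ * _ + _); rewrite /x mxE.
    - by apply: integrable01_sub => //; apply: integrable01Z; exact: hu.
    - apply: integrable01_sub => //; apply: integrable01_sum => j.
      by apply: integrable01Z; exact: hu.
  by rewrite gen.
apply: le_Rintegral => //; [exact: integrable01_sub|..].
  by apply: integrable01_sub => //; exact: integrable01Z.
by move=> s _; exact: cauchy_schwarz.
Qed.

End Vector.
End IntegralCalculus.

Section Controls.
Variables (R : realType) (m n2 : nat) (b : 'I_n2 -> 'M[R]_m).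
Hypothesis hskew : skew_family b.
Notation mu := (@lebesgue_measure R).
Implicit Types (p q : pt R m n2).

(* Controls vanishing after some time [a < 1] can be prolonged by a further
   segment without reparametrising what was already built. *)
Lemma walk_control (s : seq 'rV[R]_m) p : exists a u,
  [/\ 0 <= a < 1, horizontal_control b p (walk b p s) u,
      (forall t, a < t -> u t = 0) &
      Rintegral mu `[0, 1] (fun t => enorm (u t)) = wlen s].
Proof.
elim/last_ind: s => [|s x [a [u [/andP[a0 a1] [hu [hB [q1 q2]]] ua ul]]]].
  have z0 (k : nat) t : vint (fun=> 0 : 'rV[R]_k) 0 t = 0 by apply: vint_eq0.
  have i0 (k : nat) : vintegrable (fun=> 0 : 'rV[R]_k).
    by move=> i; apply: eq_integrable (integrable01_cst 0) => // t _ /=; rewrite mxE.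
  exists 0, (fun=> 0); split => //; first by rewrite lexx ltr01.
    split=> //; split; last split => /=.
    - by apply: eq_vintegrable (i0 _) => t _; rewrite Bform0r.
    - by rewrite z0 addr0.
    - by rewrite vint_eq0 ?addr0// => t _; rewrite Bform0r.
  by rewrite Rintegral_eq0 /wlen ?big_nil// => t _; rewrite enorm0.
set q := walk b p s in q1 q2.
(* The new segment uses half of the remaining time, and the factor [c] makes the integral of its
   control equal to [x]. *)
pose a' := (a + 1) / 2; pose c := (a' - a)^-1.
have aa' : a < a' by rewrite /a'; lra.
have a'1 : a' < 1 by rewrite /a'; lra.
have c0 : 0 < c by rewrite invr_gt0 subr_gt0.
have ca : (a' - a) * c = 1 by rewrite mulfV// gt_eqF// subr_gt0.
(* Left-open, so that the old control is unchanged on [[0, a]], endpoint included. *)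
pose w := (\1_(`]a, a'] : set R)) : R -> R.
have w0 t : t <= a \/ a' < t -> w t = 0.
  move=> h; rewrite /w indicE memNset//= in_itv /=.
  by case: h => h; apply/negP; rewrite negb_and -!leNgt -?ltNge h ?orbT.
have wi : integrable01 w by exact: integrable01_indic.
have w1 : Rintegral mu `[0, 1] w = a' - a by rewrite Rintegral_indic01// ltW.
pose u' t := u t + w t *: (c *: x).
have g1' t : 0 <= t -> t <= 1 ->
    vint u' 0 t = vint u 0 t + Rintegral mu `[0, t] w *: (c *: x).
  move=> t0 t1; rewrite -vintZ// -vintD//; exact: vintegrableZ.
have hB' t : 0 <= t -> t <= 1 ->
    Bform b (p.1 + vint u' 0 t) (u' t) =
    Bform b (p.1 + vint u 0 t) (u t) + w t *: Bform b q.1 (c *: x).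
  move=> t0 t1; have [ta|ta] := leP t a.
    rewrite g1'// Rintegral_eq0; last first.
      by move=> r /andP[_ rt]; apply: w0; left; exact: le_trans ta.
    by rewrite /u' w0 ?scale0r ?addr0//; left.
  rewrite /u' !ua// Bform0r !add0r BformZr g1'//; congr (_ *: _).
  (* The part of the segment already travelled is parallel to [x] and drops out by skewness, so only
     the vertex [q] matters. *)
  rewrite addrA BformDl BformZl (Bformxx hskew) scaler0 addr0; congr (Bform b _ _).
  rewrite q1 (@vint_chasles _ _ u 0 t 1)//.
  have -> : vint u t 1 = 0.
    by apply: vint_eq0 => r /andP[tr _]; apply: ua; exact: lt_le_trans tr.
  by rewrite addr0.
have hu' : vintegrable u' by apply: vintegrableD => //; exact: vintegrableZ.
exists a', u'; split.
- by rewrite a'1 (le_trans a0 (ltW aa')).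
- split=> //; split; last split.
  + apply: (@eq_vintegrable _ _ (fun t => Bform b (p.1 + vint u 0 t) (u t) +
        w t *: Bform b q.1 (c *: x))).
      by move=> t /andP[t0 t1]; rewrite hB'.
    by apply: vintegrableD => //; exact: vintegrableZ.
  + rewrite g1'// w1 scalerA ca scale1r addrA -q1.
    by rewrite -cats1 walk_cat.
  + rewrite (@eq_vint _ _ _ (fun t => Bform b (p.1 + vint u 0 t) (u t) +
        w t *: Bform b q.1 (c *: x))).
      rewrite vintD//; last exact: vintegrableZ.
      rewrite vintZ// w1 BformZr scalerA ca scale1r addrA -q2.
      by rewrite -cats1 walk_cat /= addr0.
    by move=> t /andP[t0 t1]; rewrite hB'.
- move=> t a't; rewrite /u' ua ?(lt_trans aa')// w0 ?scale0r ?addr0//.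
  by right.
- have e t : enorm (u' t) = enorm (u t) + w t * enorm (c *: x).
    have [ta|ta] := leP t a; first by rewrite /u' w0 ?scale0r ?mul0r ?addr0//; left.
    by rewrite /u' ua// add0r enormZ enorm0 add0r ger0_norm.
  have -> : (fun t => enorm (u' t)) = (fun t => enorm (u t) + w t * enorm (c *: x)).
    exact/funext.
  rewrite RintegralD//; last 2 first.
  + exact: integrable01_enorm.
  + have := integrable01Z (enorm (c *: x)) wi.
    by apply: eq_integrable => // t _ /=; rewrite mulrC.
  rewrite ul RintegralZr// w1 enormZ mulrA ger0_norm ?(ltW c0)// ca mul1r.
  by rewrite -cats1 wlen_cat /wlen big_seq1.
Qed.

Definition control_lengths p q : set R :=
  [set l | exists u, horizontal_control b p q u /\
     l = Rintegral mu `[0, 1] (fun s => enorm (u s))].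

Lemma control_lengths_ge0 p q l : control_lengths p q l -> 0 <= l.
Proof. by move=> [u [_ ->]]; apply: Rintegral_ge0 => s _; exact: enorm_ge0. Qed.

Lemma ccdist_walk p s : ccdist b p (walk b p s) <= wlen s.
Proof.
have [a [u [_ hu _ <-]]] := walk_control s p.
apply: ge_inf; last by exists u.
by exists 0 => l; exact: control_lengths_ge0.
Qed.

Lemma ccdist_ge0 p q : 0 <= ccdist b p q.
Proof.
rewrite /ccdist -/(control_lengths p q).
(* By convention the infimum of the empty set is 0. *)
have [->|/set0P h] := eqVneq (control_lengths p q) set0; first by rewrite inf0.
by apply: lb_le_inf => // l; exact: control_lengths_ge0.
Qed.

End Controls.

(** * Displacements in the second layer *)

Section Box.
Variables (R : realType) (m n2 : nat) (b : 'I_n2 -> 'M[R]_m).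
Hypothesis hskew : skew_family b.

(** The list is chosen before [p]: the displacement is central, so one list serves all starting
    points and lists can be concatenated. *)
Definition central_reach (y : 'rV[R]_n2) (l : R) := exists2 s : seq 'rV[R]_m,
  wlen s <= l & forall p, walk b p s = gmul b p (0, y).

Lemma central_reach_le y l l' : l <= l' -> central_reach y l -> central_reach y l'.
Proof. by move=> ll [s sl hs]; exists s => //; exact: le_trans ll. Qed.

Lemma central_reachD y1 l1 y2 l2 : central_reach y1 l1 -> central_reach y2 l2 ->
  central_reach (y1 + y2) (l1 + l2).
Proof.
move=> [s1 h1 e1] [s2 h2 e2]; exists (s1 ++ s2); first by rewrite wlen_cat lerD.
by move=> p; rewrite walk_cat e1 e2 -gmulA /gmul /= Bform0l !addr0.
Qed.

Lemma central_reach0 : central_reach 0 0.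
Proof.
exists [::]; first by rewrite /wlen big_nil.
by move=> p; rewrite gmul0.
Qed.

Lemma central_reach_sum (I : Type) (r : seq I) (y : I -> 'rV[R]_n2) (l : I -> R) :
  (forall i, central_reach (y i) (l i)) ->
  central_reach (\sum_(i <- r) y i) (\sum_(i <- r) l i).
Proof.
move=> h; apply: (big_ind2 central_reach) => [|y1 l1 y2 l2|i _].
- exact: central_reach0.
- exact: central_reachD.
- exact: h.
Qed.

(** The commutator loop closes up in the first layer and encloses an area in the second; its sides
    scale like the square root of that area. *)
Lemma central_reach_commutator r (x y : 'rV[R]_m) :
  central_reach (r *: Bform b x y) (2 * Num.sqrt `|r| * (enorm x + enorm y)).
Proof.
(* The loop contributes [2 a c B(x, y)], whence the factor 1/2; the sign of [r] is put into [c]. *)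
pose a := Num.sqrt `|r|; pose c := Num.sg r * (a / 2).
have a0 : 0 <= a by exact: sqrtr_ge0.
have ac : 2 * (a * c) = r.
  rewrite /c; transitivity (Num.sg r * a ^+ 2); first by field.
  by rewrite sqr_sqrtr// -numEsg.
exists [:: a *: x; c *: y; - (a *: x); - (c *: y)].
  rewrite /wlen !big_cons big_nil !enormN !enormZ.
  have ca : `|c| <= a.
    rewrite /c normrM (ger0_norm (_ : 0 <= a / 2)) ?divr_ge0//.
    by rewrite normr_sg; case: (r != 0); rewrite ?mul1r ?mul0r//; lra.
  rewrite (ger0_norm a0).
  have := ler_wpM2r (enorm_ge0 y) ca.
  by rewrite -/a; lra.
move=> p; rewrite /= -!gmulA; congr gmul.
rewrite /gmul /= !addr0 !add0r; congr (_, _).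
  by rewrite addrA addrC -addrA; apply/rowP => i; rewrite !mxE; ring.
rewrite !BformDr !BformNr !BformNl !BformZl !BformZr !opprK !(Bformxx hskew).
rewrite (BformC hskew y x) -ac.
by move: (Bform b x y) => z; apply/rowP => i; rewrite !mxE; ring.
Qed.

(** Ball-box estimate: expand [y] along the brackets spanning the second layer and join the
    commutator loops of the terms. *)
Lemma central_reach_sqrt : step2_generating b -> exists2 K : R, 0 <= K &
  forall y, central_reach y (K * Num.sqrt (enorm y)).
Proof.
move=> [_ hstep].
have /choice [c hc] : forall k : 'I_n2, exists c : 'I_m -> 'I_m -> R,
    delta_mx 0 k = \sum_(i < m) \sum_(j < m) c i j *:
      Bform b (delta_mx 0 i) (delta_mx 0 j) by move=> k; exact: hstep.
pose e (i : 'I_m) : 'rV[R]_m := delta_mx 0 i.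
exists (\sum_k \sum_i \sum_j 2 * Num.sqrt `|c k i j| * (enorm (e i) + enorm (e j))).
  do 3! (apply: sumr_ge0 => ? _).
  by rewrite !mulr_ge0 ?sqrtr_ge0// addr_ge0 ?enorm_ge0.
move=> y.
have ey : y = \sum_k \sum_i \sum_j (y 0 k * c k i j) *: Bform b (e i) (e j).
  rewrite {1}(row_sum_delta y); apply: eq_bigr => k _.
  rewrite hc scaler_sumr; apply: eq_bigr => i _.
  by rewrite scaler_sumr; apply: eq_bigr => j _; rewrite scalerA.
rewrite [X in central_reach X _]ey.
rewrite [_ * Num.sqrt _]mulr_suml; apply: central_reach_sum => k.
rewrite [_ * Num.sqrt _]mulr_suml; apply: central_reach_sum => i.
rewrite [_ * Num.sqrt _]mulr_suml; apply: central_reach_sum => j.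
apply: central_reach_le (central_reach_commutator _ _ _).
rewrite normrM sqrtrM// [leRHS]mulrAC; apply: ler_wpM2r.
  by rewrite addr_ge0 ?enorm_ge0.
rewrite -mulrA ler_wpM2l// mulrC ler_wpM2l ?sqrtr_ge0// ler_wsqrtr//.
exact: ler_coord_enorm.
Qed.

End Box.

(** * Approximation of horizontal curves by polygons *)

Section Approximation.
Variables (R : realType) (m n2 : nat) (b : 'I_n2 -> 'M[R]_m).
Notation mu := (@lebesgue_measure R).

Lemma vintegrable_Bform x (u : R -> 'rV[R]_m) : vintegrable u ->
  vintegrable (fun s => Bform b x (u s)).
Proof.
move=> hu k; have : integrable01 (fun s => \sum_j (\sum_i x 0 i * b k i j) * u s 0 j).
  by apply: integrable01_sum => j; apply: integrable01Z; exact: hu.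
apply: eq_integrable => // s _ /=; rewrite Bform_coord; congr EFin.
by apply: eq_bigr => j _; rewrite big_distrl.
Qed.

Lemma vint_Bform x (u : R -> 'rV[R]_m) a c : 0 <= a -> c <= 1 -> vintegrable u ->
  vint (fun s => Bform b x (u s)) a c = Bform b x (vint u a c).
Proof.
move=> a0 c1 hu; apply/rowP => k; rewrite Bform_coord mxE.
have gen (r : seq 'I_m) (h : 'I_m -> R) :
    Rintegral mu `[a, c] (fun s => \sum_(j <- r) h j * u s 0 j)
    = \sum_(j <- r) h j * vint u a c 0 j.
  elim: r => [|j r IH]; first by rewrite big_nil Rintegral_eq0// => s _; rewrite big_nil.
  rewrite big_cons -IH mxE -RintegralZl//; last exact: integrable01_sub (hu j).
  rewrite -RintegralD//.
  - by apply: eq_Rintegral => s _; rewrite big_cons.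
  - by apply: integrable01_sub => //; apply: integrable01Z; exact: hu.
  - apply: integrable01_sub => //; apply: integrable01_sum => i.
    by apply: integrable01Z; exact: hu.
under eq_bigr do rewrite -big_distrl /=.
rewrite -gen; apply: eq_Rintegral => s _; rewrite Bform_coord.
by apply: eq_bigr => j _; rewrite big_distrl.
Qed.

Lemma vintaa k (u : R -> 'rV[R]_k) a : vint u a a = 0.
Proof. by apply/rowP => i; rewrite !mxE set_itv1 Rintegral_set1. Qed.

Variables (c : R) (c0 : 0 <= c).
Hypothesis hc : forall x y, enorm (Bform b x y) <= c * (enorm x * enorm y).

(** Passing to the chord changes the integrand by [B(vint u a s, u s)]. The first argument is
    bounded by the length of the piece and the second integrates to it, so the error is
    quadratic. *)
Lemma chord_error (p : pt R m n2) (u : R -> 'rV[R]_m) a d :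
  vintegrable u -> vintegrable (fun s => Bform b (p.1 + vint u 0 s) (u s)) ->
  0 <= a -> a <= d -> d <= 1 ->
  enorm (vint (fun s => Bform b (p.1 + vint u 0 s) (u s)) a d -
         Bform b (p.1 + vint u 0 a) (vint u a d)) <=
  c * Rintegral mu `[a, d] (fun s => enorm (u s)) ^+ 2.
Proof.
move=> hu hB a0 ad d1; set x := p.1 + vint u 0 a.
have hx := vintegrable_Bform (- x) hu.
rewrite -BformNl -(vint_Bform _ a0 d1 hu) -(vintD a0 d1 hB hx).
set M := Rintegral _ _ _.
have iu := integrable01_enorm hu.
have hM : M * c * M = Rintegral mu `[a, d] (fun s => M * c * enorm (u s)).
  by rewrite RintegralZl//; exact: integrable01_sub.
rewrite expr2 [leRHS]mulrCA mulrA hM.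
apply: le_trans (enorm_vint a0 d1 (vintegrableD hB hx)) _.
apply: le_Rintegral => //.
- apply: integrable01_sub => //; apply: integrable01_enorm; exact: vintegrableD.
- by apply: integrable01_sub => //; exact: integrable01Z.
move=> s /=; rewrite in_itv /= => /andP[as_ sd].
rewrite -BformDl (le_trans (hc _ _))// mulrA ler_wpM2r ?enorm_ge0// mulrC.
apply: ler_wpM2r => //.
rewrite (vint_chasles (lexx 0) a0 as_ (le_trans sd d1) hu).
rewrite addrA -/x addrAC subrr add0r.
rewrite (le_trans (enorm_vint a0 (le_trans sd d1) hu))//.
rewrite /M (Rintegral_chasles a0 as_ sd d1 iu) lerDl.
by apply: Rintegral_ge0 => r _; exact: enorm_ge0.
Qed.

(* Cutting a curve into N pieces of equal length and replacing each of them by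
   its chord keeps the energy below the squared length. *)
Lemma chords (p q : pt R m n2) (u : R -> 'rV[R]_m) (eps : R) (N : nat) :
  horizontal_control b p q u -> 0 < eps -> (0 < N)%N ->
  let l := Rintegral mu `[0, 1] (fun s => enorm (u s)) + eps in
  exists f : nat -> 'rV[R]_m,
  [/\ forall i, (i < N)%N -> enorm (f i) <= l / N%:R,
      (walk b p (mkseq f N)).1 = q.1 &
      enorm ((walk b p (mkseq f N)).2 - q.2) <= c * l ^+ 2 / N%:R].
Proof.
move=> [hu [hB [q1 q2]]] eps0 N0 l.
have NR : 0 < N%:R :> R by rewrite ltr0n.
have iu := integrable01_enorm hu.
(* The summand [eps * t] makes [L] strictly increasing even where [u] vanishes, so the cutting times
   are ordered, start at 0 and end at 1. *)
pose L t := Rintegral mu `[0, t] (fun s => enorm (u s)) + eps * t.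
have L0 : L 0 = 0 by rewrite /L set_itv1 Rintegral_set1 mulr0 addr0.
have L1 : L 1 = l by rewrite /L mulr1.
have dL s t : 0 <= s -> s <= t -> t <= 1 ->
    Rintegral mu `[s, t] (fun r => enorm (u r)) = L t - L s - eps * (t - s).
  by move=> s0 st t1; rewrite /L (Rintegral_chasles (lexx 0) s0 st t1 iu); ring.
have Lmono s t : 0 <= s -> s <= t -> t <= 1 -> L s + eps * (t - s) <= L t.
  move=> s0 st t1; have : 0 <= Rintegral mu `[s, t] (fun r => enorm (u r)).
    by apply: Rintegral_ge0 => r _; exact: enorm_ge0.
  by rewrite dL//; lra.
have Lc : {within `[0, 1], continuous L}.
  have cI := parameterized_integral_continuous ler01 iu.
  apply: (within_continuousD cI); apply: continuous_subspaceT.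
  exact: mulrl_continuous.
have l0 : 0 < l by rewrite /l ltr_wpDl// Rintegral_ge0// => r _; exact: enorm_ge0.
have /choice [tau ht] : forall i : nat, exists t : R, (i <= N)%N ->
    [/\ 0 <= t, t <= 1 & L t = l * i%:R / N%:R].
  move=> i; have [iN|iN] := leqP i N; last by exists 0.
  have [|t] := @IVT _ L 0 1 (l * i%:R / N%:R) ler01 Lc.
    have l0' := ltW l0; rewrite L0 L1 (min_l l0') (max_r l0').
    rewrite divr_ge0 ?mulr_ge0 ?(ltW NR)//= ler_pdivrMr//.
    by rewrite ler_wpM2l// ler_nat.
  by rewrite in_itv /= => /andP[t0 t1] Lt; exists t.
have tau_lt i : (i < N)%N -> tau i <= tau i.+1.
  move=> iN; have [a0 a1 La] := ht i (ltnW iN); have [d0 d1 Ld] := ht i.+1 iN.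
  rewrite leNgt; apply/negP => da.
  have := Lmono _ _ d0 (ltW da) a1; rewrite La Ld.
  have : 0 < eps * (tau i - tau i.+1) by rewrite mulr_gt0 ?subr_gt0.
  have : l * i%:R / N%:R <= l * i.+1%:R / N%:R.
    by rewrite ler_wpM2r ?invr_ge0 ?(ltW NR)// ler_wpM2l ?(ltW l0)// ler_nat.
  by lra.
have tau0 : tau 0%N = 0.
  have [a0 a1 La] := ht 0%N (leq0n _); have := Lmono _ _ (lexx 0) a0 a1.
  rewrite La L0 mulr0 mul0r subr0 add0r pmulr_rle0// => a0'.
  by apply/eqP; rewrite eq_le a0 a0'.
have tauN : tau N = 1.
  have [a0 a1 La] := ht N (leqnn _); have := Lmono _ _ a0 a1 (lexx 1).
  rewrite La L1 mulfK ?gt_eqF// gerDl pmulr_rle0// subr_le0 => a1'.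
  by apply/eqP; rewrite eq_le a1 a1'.
pose f i := vint u (tau i) (tau i.+1).
have len i : (i < N)%N -> Rintegral mu `[tau i, tau i.+1] (fun r => enorm (u r)) <= l / N%:R.
  move=> iN; have [a0 a1 La] := ht i (ltnW iN); have [d0 d1 Ld] := ht i.+1 iN.
  rewrite dL ?tau_lt// La Ld -natr1.
  have : 0 <= eps * (tau i.+1 - tau i) by rewrite mulr_ge0 ?(ltW eps0)// subr_ge0 tau_lt.
  by rewrite (mulrDr l) mulr1 (mulrDl _ l); lra.
pose g2 t := p.2 + vint (fun s => Bform b (p.1 + vint u 0 s) (u s)) 0 t.
have main i : (i <= N)%N ->
    (walk b p (mkseq f i)).1 = p.1 + vint u 0 (tau i) /\
    enorm ((walk b p (mkseq f i)).2 - g2 (tau i)) <= i%:R * (c * (l / N%:R) ^+ 2).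
  elim: i => [_|i IH iN].
    by rewrite /= tau0 /g2 !vintaa !addr0 subrr enorm0 mul0r.
  have [a0 a1 La] := ht i (ltnW iN); have [d0 d1 Ld] := ht i.+1 iN.
  have [e1 e2] := IH (ltnW iN).
  rewrite mkseqS -cats1 walk_cat /= e1; split.
    by rewrite -addrA -vint_chasles// tau_lt.
  rewrite addr0 /g2 (vint_chasles (lexx 0) a0 (tau_lt _ iN) d1 hB).
  set P := (walk _ _ _).2; set B2 := vint _ (tau i) _;
    set B1 := vint (fun s => Bform b (p.1 + vint u 0 s) (u s)) 0 _.
  have -> : P + Bform b (p.1 + vint u 0 (tau i)) (f i) - (p.2 + (B1 + B2)) =
      (P - (p.2 + B1)) - (B2 - Bform b (p.1 + vint u 0 (tau i)) (f i)).
    by move: (Bform b _ _) => z; apply/rowP => j; rewrite !mxE; ring.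
  rewrite (le_trans (ler_enormD _ _))// enormN -natr1 mulrDl mul1r lerD//.
  apply: (le_trans (chord_error hu hB a0 (tau_lt _ iN) d1)).
  rewrite ler_wpM2l// ler_pXn2r ?nnegrE ?len//.
    by apply: Rintegral_ge0 => r _; exact: enorm_ge0.
  by rewrite divr_ge0 ?(ltW l0)// ltW.
have [e1 e2] := main N (leqnn _).
exists f; split.
- move=> i iN; have [a0 a1 La] := ht i (ltnW iN); have [d0 d1 Ld] := ht i.+1 iN.
  by rewrite (le_trans _ (len _ iN))// enorm_vint.
- by rewrite e1 tauN q1.
- move: e2; rewrite /g2 tauN -q2 => /le_trans; apply.
  rewrite le_eqVlt; apply/orP; left; apply/eqP; field.
  by rewrite gt_eqF.
Qed.

End Approximation.

(** * Metric properties of the Carnot-Caratheodory distance *)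

Section Distance.
Variables (R : realType) (m n2 : nat) (b : 'I_n2 -> 'M[R]_m).
Hypothesis hskew : skew_family b.
Hypothesis hstep : step2_generating b.
Implicit Types (p q r : pt R m n2) (s : seq 'rV[R]_m).

Lemma central_reach_gmul p q (y : 'rV[R]_n2) l : central_reach b (q.2 - p.2) l ->
  q.1 = p.1 -> exists2 s, wlen s <= l & walk b p s = q.
Proof.
move=> [s sl hs] e; exists s => //; rewrite hs /gmul /= Bform0r !addr0.
by rewrite -e addrC subrK; case: (q).
Qed.

(** Chow's theorem in this setting: one horizontal segment, then a central displacement. It makes
    the set behind the infimum in [ccdist] nonempty. *)
Lemma walk_connect p q : exists s, walk b p s = q.
Proof.
have [K _ hK] := central_reach_sqrt hskew hstep.
pose r := walk b p [:: q.1 - p.1].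
have r1 : q.1 = r.1 by rewrite /r /= addrC subrK.
have [s _ hs] := central_reach_gmul 0 (hK (q.2 - r.2)) r1.
by exists ([:: q.1 - p.1] ++ s); rewrite walk_cat hs.
Qed.

Lemma ccdist_control p q (e : R) : 0 < e -> exists2 u, horizontal_control b p q u &
  Rintegral (@lebesgue_measure R) `[0, 1] (fun t => enorm (u t)) < ccdist b p q + e.
Proof.
move=> e0; have [s hs] := walk_connect p q.
have [a [u [_ hu _ _]]] := walk_control hskew s p.
have hi : has_inf (control_lengths b p q).
  split; last by exists 0 => l; exact: control_lengths_ge0.
  exists (Rintegral (@lebesgue_measure R) `[0, 1] (fun t => enorm (u t))).
  by exists u; rewrite -hs.
have [l [v [hv ->]] hl] := inf_adherent e0 hi.
by exists v.
Qed.

Lemma ccdist_chords p q : exists2 c : R, 0 <= c & forall (l : R) (N : nat),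
  ccdist b p q < l -> (0 < N)%N -> exists f : nat -> 'rV[R]_m,
  [/\ forall i, (i < N)%N -> enorm (f i) <= l / N%:R,
      (walk b p (mkseq f N)).1 = q.1 &
      enorm ((walk b p (mkseq f N)).2 - q.2) <= c * l ^+ 2 / N%:R].
Proof.
have [c c0 hc] := Bform_bounded b; exists c => // l N dl N0.
have e0 : 0 < l - ccdist b p q by rewrite subr_gt0.
have [u hu ul] := ccdist_control p q e0.
rewrite addrC subrK in ul.
rewrite -subr_gt0 in ul.
by have := chords c0 hc hu ul N0; rewrite /= [_ + (l - _)]addrC subrK.
Qed.

(** The chord polygon with [N] steps misses [q] by [O(1/N)] in the second layer, and loops of length
    [O(N^(-1/2))] close the gap. Hence polygons alone determine the distance, and they concatenate
    and reverse without reparametrization. *)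
Lemma walk_approx p q (e : R) : 0 < e ->
  exists2 s, walk b p s = q & wlen s <= ccdist b p q + e.
Proof.
move=> e0; have [K K0 hK] := central_reach_sqrt hskew hstep.
have [c c0 hc] := ccdist_chords p q.
pose l := ccdist b p q + e / 2.
have dl : ccdist b p q < l by rewrite ltrDl divr_gt0.
have [M hM] : exists M : nat, K ^+ 2 * (c * l ^+ 2) / (e / 2) ^+ 2 < M.+1%:R.
  by exists (Num.truncn (K ^+ 2 * (c * l ^+ 2) / (e / 2) ^+ 2)); exact: truncnS_gt.
have [f [fl f1 f2]] := hc l M.+1 dl isT.
set r := walk b p (mkseq f M.+1) in f1 f2.
have [s sl hs] := central_reach_gmul 0 (hK (q.2 - r.2)) (esym f1).
exists (mkseq f M.+1 ++ s); first by rewrite walk_cat hs.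
rewrite wlen_cat wlen_mkseq [e]splitr addrA lerD//.
  rewrite -/l (le_trans (ler_sum _ (fun i _ => fl _ (ltn_ord i))))//.
  rewrite sumr_const card_ord -[_ *+ _]mulr_natr divfK//.
apply: (le_trans sl).
rewrite -(@ler_pXn2r _ 2) ?nnegrE ?mulr_ge0 ?sqrtr_ge0 ?divr_ge0 ?(ltW e0)//.
rewrite exprMn sqr_sqrtr ?enorm_ge0// -enormN opprB.
apply: le_trans (_ : K ^+ 2 * (c * l ^+ 2 / M.+1%:R) <= _).
  by rewrite ler_wpM2l ?exprn_ge0.
by rewrite mulrA ler_pdivrMr// [leRHS]mulrC -ler_pdivrMr ?exprn_gt0 ?divr_gt0// ltW.
Qed.

(* Otherwise unification may unfold the infimum when two distances differ. *)
Local Opaque ccdist.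

Lemma ccdist_triangle q p r : ccdist b p r <= ccdist b p q + ccdist b q r.
Proof.
apply/ler_addgt0Pr => e e0; have e2 : 0 < e / 2 by rewrite divr_gt0.
have [s1 h1 l1] := walk_approx p q e2; have [s2 h2 l2] := walk_approx q r e2.
have := ccdist_walk hskew p (s1 ++ s2).
rewrite walk_cat h1 h2 wlen_cat => /le_trans; apply.
by move: (lerD l1 l2); rewrite addrACA -splitr.
Qed.

Lemma ccdistC p q : ccdist b p q = ccdist b q p.
Proof.
suff h p' q' : ccdist b q' p' <= ccdist b p' q'.
  move: (h p q) (h q p); move: (ccdist b p q) (ccdist b q p) => x y yx xy.
  by apply: le_anti; rewrite xy.
apply/ler_addgt0Pr => e e0; have [s hs l] := walk_approx p' q' e0.
have [s' l' hs'] := walk_rev hskew s.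
have h := ccdist_walk hskew (walk b p' s) s'; rewrite hs' hs l' in h.
exact: le_trans h l.
Qed.

Lemma ccdist_central : exists2 K : R, 0 <= K & forall p q, p.1 = q.1 ->
  ccdist b p q <= K * Num.sqrt (enorm (q.2 - p.2)).
Proof.
have [K K0 hK] := central_reach_sqrt hskew hstep; exists K => // p q e.
have [s sl hs] := central_reach_gmul 0 (hK (q.2 - p.2)) (esym e).
rewrite -{1}hs; exact: le_trans (ccdist_walk hskew p s) sl.
Qed.

(** After the horizontal step [q.1 - p.1] the central gap is bounded linearly by the Euclidean
    displacement, and closing it costs a square root; hence the square in the choice of [d]. *)
Lemma ccdist_euclidean p (e : R) : 0 < e -> exists2 d : R, 0 < d &
  forall q, ptnorm (q.1 - p.1, q.2 - p.2) < d -> ccdist b q p < e.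
Proof.
move=> e0; have [K K0 hK] := ccdist_central; have [c c0 hc] := Bform_bounded b.
pose M := 1 + c * enorm p.1.
have M1 : 1 <= M by rewrite lerDl mulr_ge0 ?enorm_ge0.
pose d := Num.min (e / 2) ((e / 2 / (K + 1)) ^+ 2 / M).
have M0 : 0 < M by rewrite (lt_le_trans ltr01).
have K1 : 0 < K + 1 by rewrite ltr_wpDl.
have d0 : 0 < d by rewrite lt_min !divr_gt0 ?exprn_gt0 ?divr_gt0.
exists d => // q hq; rewrite ccdistC.
pose x := q.1 - p.1; pose y := q.2 - p.2.
have [hx hy] : enorm x < d /\ enorm y < d.
  split; apply: le_lt_trans hq; rewrite -[leLHS]ger0_norm ?enorm_ge0//;
  by rewrite -sqrtr_sqr ler_wsqrtr//= ?lerDl ?lerDr sqr_ge0.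
apply: le_lt_trans (ccdist_triangle (walk b p [:: x]) _ _) _.
have h1 : ccdist b p (walk b p [:: x]) <= enorm x.
  by rewrite (le_trans (ccdist_walk _ _ _))// /wlen big_seq1.
have h2 := hK (walk b p [:: x]) q.
have {}h2 := h2 (_ : _ = _); rewrite /= addr0 in h2.
have {}h2 : ccdist b (walk b p [:: x]) q <= e / 2.
  apply: le_trans (h2 _) _; first by rewrite addrC subrK.
  have hz : enorm (q.2 - (p.2 + Bform b p.1 x)) <= d * M.
    rewrite opprD addrA (le_trans (ler_enormD _ _))// enormN mulrDr mulr1.
    rewrite lerD ?(ltW hy)// (le_trans (hc _ _))// mulrA mulrC.
    by rewrite ler_wpM2r ?mulr_ge0 ?enorm_ge0// ltW.
  have {}hz : enorm (q.2 - (p.2 + Bform b p.1 x)) <= (e / 2 / (K + 1)) ^+ 2.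
    apply: (le_trans hz); rewrite -ler_pdivlMr//; by rewrite ge_min lexx orbT.
  have h : Num.sqrt (enorm (q.2 - (p.2 + Bform b p.1 x))) <= e / 2 / (K + 1).
    have h0 : 0 <= e / 2 / (K + 1) by rewrite !divr_ge0 ?(ltW e0) ?(ltW K1).
    by rewrite -(ger0_norm h0) -sqrtr_sqr ler_wsqrtr.
  apply: (le_trans (ler_wpM2l K0 h)).
  rewrite mulrCA ler_piMr ?divr_ge0 ?(ltW e0)// ler_pdivrMr// mul1r lerDl.
  exact: ler01.
have h3 : enorm x < e / 2 by rewrite (lt_le_trans hx)// ge_min lexx.
have h4 := ltr_leD (le_lt_trans h1 h3) h2.
by rewrite -splitr in h4.
Qed.

End Distance.

(** * Penalized minimal polygons *)

Section Minimizer.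
Variables (R : realType) (m n2 : nat) (b : 'I_n2 -> 'M[R]_m).

(** The first term is the energy of the polygon when each step takes time [1 / N]. Only the second
    layer is penalized: the first layer constraint is linear and can be kept exactly. *)
Definition cost (N : nat) (K : R) (z : 'rV[R]_n2) (f : nat -> 'rV[R]_m) : R :=
  N%:R * \sum_(i < N) enorm (f i) ^+ 2 + K * enorm (pB b f f N - z) ^+ 2.

Lemma eq_psum (f g : nat -> 'rV[R]_m) N : (forall i, (i < N)%N -> f i = g i) ->
  psum f N = psum g N.
Proof. by move=> fg; apply: eq_bigr => i _; exact: fg. Qed.

Lemma eq_cost N K z f g : (forall i, (i < N)%N -> f i = g i) ->
  cost N K z f = cost N K z g.
Proof.
move=> fg; rewrite /cost.
have -> : pB b f f N = pB b g g N.
  apply: eq_bigr => i _; rewrite fg// (@eq_psum f g)// => j ji.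
  by apply: fg; exact: ltn_trans (ltn_ord i).
by congr (_ * _ + _); apply: eq_bigr => i _; rewrite fg.
Qed.

Lemma continuous_addr (T : topologicalType) (f g : T -> R) :
  continuous f -> continuous g -> continuous (fun x => f x + g x).
Proof. by move=> cf cg x; apply: (@continuousD _ R _ f g); [exact: cf|exact: cg]. Qed.

Lemma continuous_sumr (T : topologicalType) (I : Type) (r : seq I) (F : I -> T -> R) :
  (forall i, continuous (F i)) -> continuous (fun x => \sum_(i <- r) F i x).
Proof.
move=> hF; elim: r => [|i r IH].
  have -> : (fun x => \sum_(i <- [::]) F i x) = (fun=> 0).
    by apply/funext => x; rewrite big_nil.
  exact: cst_continuous.
have -> : (fun x => \sum_(j <- i :: r) F j x) = (fun x => F i x + \sum_(j <- r) F j x).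
  by apply/funext => x; rewrite big_cons.
exact: continuous_addr.
Qed.

Lemma continuous_mulr (T : topologicalType) (f g : T -> R) :
  continuous f -> continuous g -> continuous (fun x => f x * g x).
Proof. by move=> cf cg x; apply: continuousM; [exact: cf|exact: cg]. Qed.

Lemma continuous_enorm_sqr (T : topologicalType) k (h : T -> 'rV[R]_k) :
  (forall i, continuous (fun x => h x 0 i)) -> continuous (fun x => enorm (h x) ^+ 2).
Proof.
move=> ch.
have -> : (fun x => enorm (h x) ^+ 2) = (fun x => \sum_i h x 0 i * h x 0 i).
  by apply/funext => x; rewrite enorm_sqr.
by apply: continuous_sumr => i; exact: continuous_mulr.
Qed.

Lemma cost_minimizer N K z f0 : 0 <= K -> exists2 f, psum f N = psum f0 N &
  forall g, psum g N = psum f0 N -> cost N K z f <= cost N K z g.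
Proof.
move=> K0; pose T := 'rV[R]_(N * m).
(* Only the first [N] steps enter the cost, so a polygon is encoded by one row vector, which [X]
   extends by 0. *)
pose X (w : T) (i : nat) : 'rV[R]_m :=
  if insub i is Some j then row (j : 'I_N) (vec_mx w) else 0.
pose W (f : nat -> 'rV[R]_m) : T := mxvec (\matrix_(i < N, j < m) f i 0 j).
have XW f i : (i < N)%N -> X (W f) i = f i.
  move=> iN; rewrite /X insubT; apply/rowP => j.
  by rewrite mxE /W mxvecK mxE.
have Xc i j : continuous (fun w => X w i 0 j).
  rewrite /X; case: insubP => [k _ _|_].
    have -> : (fun w : T => row k (vec_mx w) 0 j) = (fun w => w 0 (mxvec_index k j)).
      by apply/funext => w; rewrite !mxE.
    exact: coord_continuous.
  have -> : (fun w : T => (0 : 'rV[R]_m) 0 j) = (fun=> 0).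
    by apply/funext => w; rewrite mxE.
  exact: cst_continuous.
have Pc i j : continuous (fun w => psum (X w) i 0 j).
  have -> : (fun w => psum (X w) i 0 j) = (fun w => \sum_(k < i) X w k 0 j).
    by apply/funext => w; rewrite summxE.
  by apply: continuous_sumr => k; exact: Xc.
have Cc : continuous (fun w => cost N K z (X w)).
  apply: continuous_addr; apply: continuous_mulr; try exact: cst_continuous.
    by apply: continuous_sumr => i; apply: continuous_enorm_sqr => j; exact: Xc.
  apply: continuous_enorm_sqr => k.
  have -> : (fun w => (pB b (X w) (X w) N - z) 0 k) = (fun w => \sum_(i < N)
     \sum_j \sum_l psum (X w) i 0 l * b k l j * X w i 0 j + - z 0 k).
    apply/funext => w; rewrite !mxE summxE; congr (_ + _).
    by apply: eq_bigr => i _; rewrite Bform_coord.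
  apply: continuous_addr; last exact: cst_continuous.
  apply: continuous_sumr => i; apply: continuous_sumr => j.
  apply: continuous_sumr => l; do 2! (apply: continuous_mulr => //).
  exact: cst_continuous.
have Dc : continuous (fun w => enorm (psum (X w) N - psum f0 N) ^+ 2).
  apply: continuous_enorm_sqr => k.
  have -> : (fun w => (psum (X w) N - psum f0 N) 0 k) =
     (fun w => psum (X w) N 0 k + - psum f0 N 0 k).
    by apply/funext => w; rewrite !mxE.
  by apply: continuous_addr; [exact: Pc|exact: cst_continuous].
pose c := cost N K z f0.
pose S : set T := [set w | enorm (psum (X w) N - psum f0 N) ^+ 2 = 0] `&`
  [set w | cost N K z (X w) <= c].
have DE w : enorm (psum (X w) N - psum f0 N) ^+ 2 = 0 <-> psum (X w) N = psum f0 N.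
  split=> [/eqP|->]; last by rewrite subrr enorm0 expr0n.
  by rewrite expf_eq0 /= => /eqP/enorm0_eq0/eqP; rewrite subr_eq0 => /eqP.
have SW : S (W f0).
  split; first by apply/DE; apply: eq_psum => i; exact: XW.
  by rewrite /= (eq_cost _ _ (XW f0)).
have Scl : closed S.
  apply: closedI.
    by move/continuous_closedP: Dc => /(_ _ (@closed_eq R 0)).
  by move/continuous_closedP: Cc => /(_ _ (@closed_le R c)).
have Sco : compact S.
  (* A coordinate with [x^2 <= c] satisfies [|x| <= c + 1], a bound that avoids a square root. *)
  have Mco : compact [set v : T | forall i, v 0 i \in `[- (c + 1), c + 1]].
    apply: (@rV_compact _ _ (fun=> `[- (c + 1), c + 1]%classic)).
    by move=> _; exact: segment_compact.
  apply: subclosed_compact Scl Mco _ => w [_ /= wc] k.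
  case/mxvec_indexP: k => i j.
  have N1 : 1 <= N%:R :> R by rewrite ler1n (leq_ltn_trans _ (ltn_ord i)).
  have h : (w 0 (mxvec_index i j)) ^+ 2 <= c.
    have -> : w 0 (mxvec_index i j) = X w i 0 j.
      rewrite /X insubT // => iN; rewrite !mxE; congr (w 0 (mxvec_index _ _)).
      exact: val_inj.
    apply: (le_trans _ wc); rewrite /cost.
    apply: (@le_trans _ _ (\sum_(i < N) enorm (X w i) ^+ 2)).
      rewrite (bigD1 i)//= ler_wpDr//.
        by apply: sumr_ge0 => *; rewrite exprn_ge0 ?enorm_ge0.
      rewrite -real_normK ?num_real// ler_pXn2r ?nnegrE ?enorm_ge0//.
      exact: ler_coord_enorm.
    rewrite ler_wpDr ?mulr_ge0 ?exprn_ge0 ?enorm_ge0//.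
    by rewrite ler_peMl// sumr_ge0// => *; rewrite exprn_ge0 ?enorm_ge0.
  rewrite in_itv /= -ler_norml.
  move: h; set x := w 0 _ => h; have := sqr_ge0 (`|x| - 1).
  have := normr_ge0 x; rewrite -(real_normK (num_real x)) in h.
  by move: (`|x|) h => y; nra.
have [w wS wmin] := @compact_EVT_min _ R (fun w => cost N K z (X w)) S
  (ex_intro _ _ SW) Sco (continuous_subspaceT Cc).
move: wS; rewrite inE => -[/DE wp wc].
exists (X w) => // g gp; rewrite -(eq_cost K z (XW g)).
have [gc|cg] := leP (cost N K z (X (W g))) c; last first.
  by rewrite (le_trans wc)// ltW.
apply: wmin; rewrite inE; split=> //; apply/DE.
by rewrite -gp; apply: eq_psum => i; exact: XW.
Qed.

End Minimizer.

Section Critical.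
Variables (R : realType) (m n2 : nat) (b : 'I_n2 -> 'M[R]_m).
Hypothesis hskew : skew_family b.

Lemma quadratic_ge0_linear0 (a c : R) : (forall e, 0 <= e * a + e ^+ 2 * c) -> a = 0.
Proof.
(* Near 0 the linear term dominates: since [d > c], the value at [- a / d] is negative unless [a] is
   0. *)
move=> h; pose d := `|c| + 1.
have d0 : 0 < d by rewrite ltr_wpDl.
have cd : c < d by rewrite (le_lt_trans (ler_norm c))// ltrDl.
have := h (- a / d).
have -> : - a / d * a + (- a / d) ^+ 2 * c = - (a ^+ 2 * (d - c) / d ^+ 2).
  by field; rewrite gt_eqF.
rewrite oppr_ge0 pmulr_lle0 ?invr_gt0 ?exprn_gt0// pmulr_lle0 ?subr_gt0// => a0.
by apply/eqP; rewrite -sqrf_eq0 eq_le a0 sqr_ge0.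
Qed.

Lemma pB_perturb (f h : nat -> 'rV[R]_m) (e : R) N :
  pB b (fun i => f i + e *: h i) (fun i => f i + e *: h i) N =
  pB b f f N + e *: (pB b f h N + pB b h f N) + e ^+ 2 *: pB b h h N.
Proof.
rewrite /pB !scalerDr !scaler_sumr -!big_split /=; apply: eq_bigr => i _.
have -> : psum (fun i => f i + e *: h i) i = psum f i + e *: psum h i.
  by rewrite /psum big_split /= scaler_sumr.
rewrite BformDl !BformDr !BformZl !BformZr scalerA -expr2 !addrA; congr (_ + _).
Qed.

Lemma psum_scale (c : nat -> R) (x : 'rV[R]_m) N :
  psum (fun i => c i *: x) N = (\sum_(i < N) c i) *: x.
Proof. by rewrite /psum scaler_suml. Qed.

(** Parallel steps stay on a horizontal line. This kills the second order effect on the second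
    layer, both for the variations and for the shift by [psi h]. *)
Lemma pB_collinear (c d : nat -> R) (x : 'rV[R]_m) N :
  pB b (fun i => c i *: x) (fun i => d i *: x) N = 0.
Proof.
rewrite /pB big1// => i _.
by rewrite psum_scale BformZl BformZr (Bformxx hskew) !scaler0.
Qed.

Lemma sum_delta (V : lmodType R) (v : nat -> V) j N : (j < N)%N ->
  \sum_(i < N) (i == j :> nat)%:R *: v i = v j.
Proof.
move=> jN; rewrite (bigD1 (Ordinal jN))//= eqxx scale1r big1 ?addr0// => i ij.
by rewrite (_ : (i == j :> nat) = false) ?scale0r//;
  apply: contra_neqF ij => /eqP e; exact: val_inj.
Qed.

(* The variation moving xi from step j to step j+1 keeps the sum of the steps and
   has no second order effect on the second layer; A is K/N times the matrix
   pairing the second layer error with B. *)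
Lemma cost_critical N K (z : 'rV[R]_n2) f : (0 < N)%N ->
  (forall g, psum g N = psum f N -> cost b N K z f <= cost b N K z g) ->
  exists2 A : 'M[R]_m, A^T = - A & forall j, (j.+1 < N)%N ->
    f j.+1 *m (1%:M + A) = f j *m (1%:M - A).
Proof.
move=> N0 fmin; have NR : 0 < N%:R :> R by rewrite ltr0n.
pose y := pB b f f N - z.
pose A0 : 'M[R]_m := \sum_k y 0 k *: b k.
have A0skew : A0^T = - A0.
  rewrite /A0 linear_sum /= -sumrN; apply: eq_bigr => k _.
  by rewrite linearZ /= hskew scalerN.
have dotB u v : dot y (Bform b u v) = dot (u *m A0) v.
  rewrite [RHS]dot_mul_tr /A0 mulmx_sumr mulmx_suml summxE; apply: eq_bigr => k _.
  by rewrite BformE -scalemxAr -scalemxAl [RHS]mxE.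
exists ((K / N%:R) *: A0); first by rewrite linearZ /= A0skew scalerN.
move=> j jN; have jN' := ltnW jN.
suff h xi : dot (N%:R *: (f j.+1 - f j) + K *: ((f j + f j.+1) *m A0)) xi = 0.
  have {h} := dot_eq0 h; set u := (f j + f j.+1) *m A0 => h.
  have {}h : f j.+1 - f j + (K / N%:R) *: u = 0.
    have := congr1 ( *:%R N%:R^-1) h.
    rewrite scaler0 scalerDr !scalerA mulVf ?gt_eqF// scale1r => <-.
    by congr (_ + _ *: _); rewrite mulrC.
  rewrite mulmxDr mulmxBr !mulmx1 -!scalemxAr.
  move: h; rewrite /u mulmxDl scalerDr.
  move: (_ *: _) (_ *: _) => u1 u2 /eqP; rewrite addrA addr_eq0 => /eqP h.
  by rewrite -[u1]opprK -h; apply/rowP => i; rewrite !mxE; ring.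
pose c i : R := (i == j.+1)%:R - (i == j)%:R.
pose h i := c i *: xi.
have c_sum i : \sum_(l < i) c l = - (i == j.+1)%:R.
  elim: i => [|i IH]; first by rewrite big_ord0 oppr0.
  by rewrite big_ord_recr /= IH /c eqSS addrA addNr add0r.
have h_sum i : psum h i = - (i == j.+1)%:R *: xi by rewrite psum_scale c_sum.
have sumc (V : lmodType R) (v : nat -> V) : \sum_(i < N) c i *: v i = v j.+1 - v j.
  rewrite -(sum_delta v jN) -(sum_delta v jN') -sumrB.
  by apply: eq_bigr => i _; rewrite scalerBl.
have D1 : pB b f h N = Bform b (f j) xi.
  transitivity (\sum_(i < N) c i *: Bform b (psum f i) xi).
    by apply: eq_bigr => i _; rewrite BformZr.
  rewrite (sumc _ (fun i => Bform b (psum f i) xi)) /psum big_ord_recr /=.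
  by rewrite BformDl addrC addKr.
have D2 : pB b h f N = Bform b (f j.+1) xi.
  transitivity (- \sum_(i < N) (i == j.+1 :> nat)%:R *: Bform b xi (f i)).
    rewrite -sumrN; apply: eq_bigr => i _.
    by rewrite h_sum BformZl scaleNr.
  by rewrite (sum_delta (fun i => Bform b xi (f i)) jN) [RHS](BformC hskew).
(* Both polarizations collapse, and [D] is [B(f j + f j.+1, xi)]: it involves two neighbouring steps
   and no vertex, which is why a recursion for the steps results. *)
pose D := pB b f h N + pB b h f N.
pose S := \sum_(i < N) enorm (h i) ^+ 2.
pose T := \sum_(i < N) dot (f i) (h i).
have ST : T = dot (f j.+1) xi - dot (f j) xi.
  rewrite -(sumc _ (fun i => dot (f i) xi : R^o)); apply: eq_bigr => i _.
  by rewrite dotZr.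
have cE e : cost b N K z (fun i => f i + e *: h i) - cost b N K z f =
    e * (2 * (N%:R * T + K * dot y D)) + e ^+ 2 * (N%:R * S + K * enorm D ^+ 2).
  rewrite /cost pB_perturb (pB_collinear _ _ xi) scaler0 addr0 -/D.
  have -> : \sum_(i < N) enorm (f i + e *: h i) ^+ 2 =
      \sum_(i < N) enorm (f i) ^+ 2 + 2 * e * T + e ^+ 2 * S.
    rewrite /T /S !mulr_sumr -!big_split /=; apply: eq_bigr => i _.
    by rewrite enorm_sqrD dotZr enormZ exprMn real_normK ?num_real// mulrA.
  have -> : pB b f f N + e *: D - z = y + e *: D by rewrite addrAC.
  rewrite (enorm_sqrD y) dotZr enormZ exprMn real_normK ?num_real//.
  by rewrite -/y; ring.
have : 2 * (N%:R * T + K * dot y D) = 0.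
  apply: (@quadratic_ge0_linear0 _ (N%:R * S + K * enorm D ^+ 2)) => e.
  rewrite -cE subr_ge0; apply: fmin.
  rewrite /psum big_split /= -scaler_sumr -/(psum h N) h_sum.
  by rewrite gtn_eqF// oppr0 scale0r scaler0 addr0.
move/eqP; rewrite mulf_eq0 pnatr_eq0 /= => /eqP <-.
by rewrite dotDl !dotZl -dotB /D D1 D2 BformDl dotDl dotNl -ST.
Qed.

End Critical.

(** * The Cayley transform of a skew matrix *)

Section Cayley.
Variables (R : realType) (m : nat).
Implicit Types (A Q : 'M[R]_m).

(** If [x (1 + A) = 0] then [x A = - x], while [x A] is orthogonal to [x]. *)
Lemma skew_unitmx A : A^T = - A -> 1%:M + A \in unitmx.
Proof.
move=> As; rewrite -row_free_unit -kermx_eq0; apply/eqP/row_matrixP => i.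
rewrite row0; set x := row i _.
have : x *m (1%:M + A) = 0 by rewrite -row_mul mulmx_ker row0.
rewrite mulmxDr mulmx1 => /eqP; rewrite addr_eq0 => /eqP xA.
apply: enorm0_eq0; apply/eqP; rewrite -sqrf_eq0 enorm_sqr.
have h : dot (x *m A) x = - dot (x *m A) x.
  rewrite {1}dot_mul_tr (_ : (x *m A *m x^T) 0 0 = (x *m A *m x^T)^T 0 0).
    by rewrite !trmx_mul trmxK As mulNmx mulmxN mulmxA mxE -dot_mul_tr.
  by rewrite [RHS]mxE.
have {}h : dot (x *m A) x = 0 by lra.
by rewrite {1}xA dotNl h oppr0.
Qed.

(** Transposition exchanges [1 + A] and [1 - A], and the two commute. *)
Lemma cayley_orthogonal A : A^T = - A ->
  let Q := (1%:M - A) *m invmx (1%:M + A) in Q *m Q^T = 1%:M.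
Proof.
move=> As Q.
have u1 := skew_unitmx As.
have u2 : 1%:M - A \in unitmx.
  by apply: skew_unitmx; rewrite linearN /= As.
set P := 1%:M + A in u1 *; set M := 1%:M - A in u2 *.
have QT : Q^T = invmx M *m P.
  by rewrite /Q trmx_mul trmx_inv /M /P !linearD linearN /= trmx1 As opprK.
have PM : P *m M = M *m P.
  by rewrite mulmxBr mulmx1 mulmxBl mul1mx mulmxDl mulmxDr mul1mx mulmx1.
have PVM : M *m invmx P = invmx P *m M.
  by rewrite -[LHS](mulKmx u1) [P *m _]mulmxA PM mulmxK.
by rewrite QT /Q -/M -/P PVM -mulmxA (mulmxA M) mulmxV// mul1mx mulVmx.
Qed.

End Cayley.

(** * Weights annihilating the vertices of a minimal polygon *)

Section Domination.
Variable R : realType.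
Implicit Types (p q P Q : {poly R}).

(** Majorants are stable under sums and products, so the Leibniz formula for a determinant can be
    estimated by a polynomial independent of the matrix. *)
Definition dominated p P := forall k, `|p`_k| <= P`_k.

Lemma dominatedD p q P Q : dominated p P -> dominated q Q -> dominated (p + q) (P + Q).
Proof. by move=> hp hq k; rewrite !coefD (le_trans (ler_normD _ _))// lerD. Qed.

Lemma dominatedM p q P Q : dominated p P -> dominated q Q -> dominated (p * q) (P * Q).
Proof.
move=> hp hq k; rewrite !coefM (le_trans (ler_norm_sum _ _ _))//.
by apply: ler_sum => i _; rewrite normrM ler_pM.
Qed.

Lemma dominated_sign (c : bool) p P : dominated p P -> dominated ((-1) ^+ c * p) P.
Proof.
by move=> hp k; rewrite mulr_sign; case: c; rewrite ?coefN ?normrN.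
Qed.

Lemma dominated_det (n : nat) (M : 'M[{poly R}]_n) P :
  (forall i j, dominated (M i j) P) -> dominated (\det M) (\sum_(s : 'S_n) P ^+ n).
Proof.
move=> hM; rewrite /determinant; apply: (big_ind2 dominated).
- by move=> k; rewrite !coef0 normr0.
- by move=> x1 x2 y1 y2 h1 h2; apply: dominatedD.
move=> s _; apply: dominated_sign.
rewrite -[X in P ^+ X]card_ord -prodr_const; apply: (big_ind2 dominated).
- by move=> k; rewrite !coef1; case: (k == 0%N); rewrite ?normr1 ?normr0.
- by move=> x1 x2 y1 y2 h1 h2; apply: dominatedM.
- by move=> i _; exact: hM.
Qed.

Lemma dominated_coef p P k : dominated p P -> `|p`_k| <= \sum_(i < size P) P`_i.
Proof.
move=> hp; have P0 i : 0 <= P`_i by exact: le_trans (normr_ge0 _) (hp i).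
apply: (le_trans (hp k)); have [kP|kP] := ltnP k (size P).
  by rewrite (bigD1 (Ordinal kP))//= lerDl sumr_ge0.
by rewrite nth_default// sumr_ge0.
Qed.

Lemma char_poly_bounded (n : nat) : exists2 C : R, 0 <= C & forall Q : 'M[R]_n,
  (forall i j, `|Q i j| <= 1) -> forall k, `|(char_poly Q)`_k| <= C.
Proof.
pose P : {poly R} := \sum_(s : 'S_n) ('X + 1) ^+ n.
exists (\sum_(i < size P) `|P`_i|); first by apply: sumr_ge0.
move=> Q hQ k; apply: (@le_trans _ _ (\sum_(i < size P) P`_i)); last first.
  by apply: ler_sum => i _; exact: ler_norm.
apply: dominated_coef; apply: dominated_det => i j l.
rewrite !mxE coefB coefMn coefX coefC coefD coefX coef1.
rewrite (le_trans (ler_normB _ _))// lerD//.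
  by case: (l == 1%N); case: (i == j); rewrite ?mulr1n ?mulr0n ?normr1 ?normr0.
by case: (l == 0%N) => //; rewrite normr0.
Qed.

End Domination.

Section Orthogonal.
Variables (R : realType).

Lemma orthogonal_expr n (Q : 'M[R]_n) s : Q *m Q^T = 1%:M -> (Q ^+ s) *m (Q ^+ s)^T = 1%:M.
Proof.
move=> hQ; elim: s => [|s IH]; first by rewrite expr0 trmx1 mulmx1.
by rewrite exprS trmx_mul mulmxA -(mulmxA Q) IH mulmx1.
Qed.

Lemma orthogonal_coord n (Q : 'M[R]_n) i j : Q *m Q^T = 1%:M -> `|Q i j| <= 1.
Proof.
move=> hQ; have := congr1 (fun M : 'M[R]_n => M i i) hQ.
rewrite !mxE eqxx mulr1n (bigD1 j)//= mxE -expr2 => h.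
rewrite -(@ler_pXn2r _ 2) ?nnegrE// expr1n real_normK ?num_real// -h lerDl.
by apply: sumr_ge0 => k _; rewrite mxE -expr2 sqr_ge0.
Qed.

Lemma orthogonal_det n (Q : 'M[R]_n) : Q *m Q^T = 1%:M -> `|\det Q| = 1.
Proof.
move=> hQ; apply/eqP; rewrite -(@eqrXn2 _ 2)// expr1n real_normK ?num_real//.
by rewrite expr2 -{2}det_tr -det_mulmx hQ det1.
Qed.

(* The characteristic polynomial of an orthogonal matrix, divided by its
   constant coefficient +-1, has coefficients bounded in terms of n only. *)
Lemma orthogonal_annihilator (n : nat) : exists2 C : R, 0 <= C &
  forall Q : 'M[R]_n.+1, Q *m Q^T = 1%:M -> exists v : nat -> R,
  [/\ v 0%N = 1, (forall k, `|v k| <= C), v n.+2 = 0 &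
      \sum_(k < n.+2) v k *: Q ^+ k = 0].
Proof.
have [C C0 hC] := char_poly_bounded R n.+1; exists C => // Q hQ.
pose p := char_poly Q; pose c := p`_0.
have c1 : `|c| = 1.
  by rewrite /c char_poly_det normrM normrX normrN1 expr1n mul1r orthogonal_det.
have c0 : c != 0 by rewrite -normr_eq0 c1 oner_eq0.
exists (fun k => p`_k / c); split.
- by rewrite mulfV.
- move=> k; rewrite normrM normfV c1 invr1 mulr1.
  by apply: hC => i j; exact: orthogonal_coord.
(* The degree is [n.+1]; this vanishing coefficient is the boundary term of the Abel summation
   below. *)
- by rewrite nth_default ?mul0r// size_char_poly.
- have h : horner_mx Q p = \sum_(k < n.+2) p`_k *: Q ^+ k.
    rewrite -{1}[p]coefK poly_def linear_sum /= size_char_poly.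
    by apply: eq_bigr => k _; rewrite linearZ /= rmorphXn /= horner_mx_X.
  transitivity (c^-1 *: horner_mx Q p); last by rewrite Cayley_Hamilton scaler0.
  by rewrite h scaler_sumr; apply: eq_bigr => k _; rewrite scalerA mulrC.
Qed.

Section Weights.
Variable n : nat.

Lemma psum_orthogonal (f : nat -> 'rV[R]_n.+1) (Q : 'M[R]_n.+1) N :
  (forall j, (j.+1 < N)%N -> f j.+1 = f j *m Q) ->
  forall j l, (j + l < N)%N -> f (j + l)%N = f j *m Q ^+ l.
Proof.
move=> fQ j; elim=> [|l IH] jl; first by rewrite addn0 expr0 mulmx1.
by rewrite addnS in jl *; rewrite fQ// IH ?(ltnW jl)// exprSr mulmxA.
Qed.

Lemma psumD (f : nat -> 'rV[R]_n.+1) a c :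
  psum f (a + c) = psum f a + psum (fun i => f (a + i)%N) c.
Proof. by rewrite /psum big_split_ord. Qed.

(** Meant for the equation [j = (k + 1) (s + 1)]: given [j] and [k] it has at most one solution [s],
    so a vertex receives at most one weight for each [k]. *)
Lemma ler_sum_unique (r : nat) (c : nat -> R) (P : pred nat) (M : R) : 0 <= M ->
  (forall i, 0 <= c i <= M) -> (forall i j, P i -> P j -> i = j) ->
  \sum_(i < r) c i * (P i)%:R <= M.
Proof.
move=> M0 hc hP; case: (pickP (fun i : 'I_r => P i)) => [i Pi|P0]; last first.
  by rewrite big1// => i _; rewrite P0 mulr0.
rewrite (bigD1 i)//= Pi mulr1 big1 ?addr0; first by have /andP[] := hc i.
move=> j ji; rewrite (_ : P j = false) ?mulr0//.
by apply: contra_neqF ji => Pj; apply: val_inj; exact: hP.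
Qed.

Lemma abel_sum (V : lmodType R) (v : nat -> R) (H : nat -> V) K : v 0%N = 1 ->
  H 0%N = 0 -> v K = 0 ->
  \sum_(k < K) (v k - v k.+1) *: H k.+1 = \sum_(k < K) v k *: (H k.+1 - H k).
Proof.
move=> v0 H0 vK.
have gen M : \sum_(k < M) (v k - v k.+1) *: H k.+1 =
   \sum_(k < M) v k *: (H k.+1 - H k) - v M *: H M.
  elim: M => [|M IH]; first by rewrite !big_ord0 H0 scaler0 subr0.
  rewrite !big_ord_recr /= IH scalerBl scalerBr.
  by rewrite !addrA; congr (_ - _); rewrite addrAC.
by rewrite gen vK scale0r subr0.
Qed.

(* Turan's argument: for every step s <= r the annihilator of Q^s gives weights
   on the vertices s, 2s, ..., and averaging over s makes them O(1/r). *)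
Lemma orthogonal_weights : exists2 C : R, 0 <= C &
  forall (f : nat -> 'rV[R]_n.+1) (Q : 'M[R]_n.+1) (r : nat),
  Q *m Q^T = 1%:M -> (0 < r)%N -> let N := (n.+2 * r).+1 in
  (forall j, (j.+1 < N)%N -> f j.+1 = f j *m Q) ->
  exists psi : nat -> R,
  [/\ \sum_(j < N) psi j = 1, \sum_(j < N) psi j *: psum f j = 0 &
      forall j, `|psi j| <= C / r%:R].
Proof.
have [C C0 hC] := orthogonal_annihilator n.
(* There are [n.+2] values of [k], each with a weight of modulus at most [2 C]. *)
exists (n.+2%:R * (C + C)); first by apply: mulr_ge0; [exact: ler0n|exact: addr_ge0].
move=> f Q r hQ r0 N fQ; have rR : 0 < r%:R :> R by rewrite ltr0n.
have /choice [v hv] : forall s : nat, exists v : nat -> R,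
    [/\ v 0%N = 1, (forall k, `|v k| <= C), v n.+2 = 0 &
    \sum_(k < n.+2) v k *: (Q ^+ s.+1) ^+ k = 0].
  by move=> s; apply: hC; exact: orthogonal_expr.
(* Differences, so that the sum telescopes to [v 0 - v n.+2 = 1] and Abel summation turns weights on
   vertices into the coefficients [v] on the blocks between them. *)
pose w s k := v s k - v s k.+1.
(* Strides run from 1 to [r]. The last vertex is [n.+2 * r], and [N] is its successor. *)
pose idx (s k : nat) := (k.+1 * s.+1)%N.
have idxN s k : (s < r)%N -> (k < n.+2)%N -> (idx s k < N)%N.
  by move=> sr kn; rewrite ltnS leq_mul.
pose psi (j : nat) : R := r%:R^-1 * \sum_(s < r) \sum_(k < n.+2) w s k * (j == idx s k)%:R.
have sum_psi (V : lmodType R) (g : nat -> V) :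
    \sum_(j < N) psi j *: g j =
    r%:R^-1 *: \sum_(s < r) \sum_(k < n.+2) w s k *: g (idx s k).
  under eq_bigr do rewrite /psi -scalerA scaler_suml.
  rewrite -scaler_sumr exchange_big /=; congr (_ *: _); apply: eq_bigr => s _.
  under eq_bigr do rewrite scaler_suml.
  rewrite exchange_big /=; apply: eq_bigr => k _.
  rewrite -(sum_delta g (idxN _ _ (ltn_ord s) (ltn_ord k))) scaler_sumr.
  by apply: eq_bigr => j _; rewrite scalerA.
exists psi; split.
- have := sum_psi R^o (fun=> 1).
  under eq_bigr do rewrite -[_ *: _]/(_ * _) mulr1.
  move=> ->; rewrite (eq_bigr (fun=> 1)) ?sumr_const ?card_ord.
    by rewrite -[_ *: _]/(_ * _) mulVf// gt_eqF.
  move=> s _; have [v0 _ vn _] := hv s.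
  under eq_bigr do rewrite -[_ *: _]/(_ * _) mulr1 /w.
  transitivity (- \sum_(0 <= k < n.+2) (v s k.+1 - v s k)).
    by rewrite big_mkord -sumrN; apply: eq_bigr => k _; rewrite opprB.
  by rewrite telescope_sumr// vn v0 sub0r opprK.
- rewrite sum_psi big1 ?scaler0// => s _; have [v0 _ vn vQ] := hv s.
  pose H k := psum f (k * s.+1).
  rewrite (eq_bigr (fun k : 'I__ => (v s k - v s k.+1) *: H k.+1))//.
  rewrite abel_sum//; last by rewrite /H mul0n /psum big_ord0.
  (* Block [k] of [s.+1] steps is block 0 rotated by [Q ^+ (k * s.+1)], so the annihilating
     polynomial of [Q ^+ s.+1] factors out. *)
  transitivity (psum f s.+1 *m \sum_(k < n.+2) v s k *: (Q ^+ s.+1) ^+ k); last first.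
    by rewrite vQ mulmx0.
  rewrite mulmx_sumr; apply: eq_bigr => k _; rewrite -scalemxAr; congr (_ *: _).
  rewrite /H mulSn addnC psumD addrAC subrr add0r /psum mulmx_suml.
  apply: eq_bigr => i _; rewrite -exprM mulnC addnC.
  apply: (psum_orthogonal fQ); rewrite ltnS.
  apply: (@leq_trans (k.+1 * s.+1)).
    by rewrite (mulSn k) (mulnC s.+1) leq_add2r ltnW.
  by rewrite leq_mul.
- move=> j; rewrite /psi normrM normfV (ger0_norm (ltW rR)) mulrC.
  rewrite ler_wpM2r ?invr_ge0 ?(ltW rR)// exchange_big /=.
  rewrite (le_trans (ler_norm_sum _ _ _))//.
  rewrite -[X in X%:R * _]card_ord mulr_natl -sumr_const; apply: ler_sum => k _.
  rewrite (le_trans (ler_norm_sum _ _ _))//.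
  under eq_bigr do rewrite normrM (ger0_norm (ler0n _ _)).
  apply: (@ler_sum_unique r (fun s => `|w s k|) (fun s => j == idx s k)).
  + by rewrite addr_ge0.
  + move=> s; have [_ vC _ _] := hv s.
    by rewrite normr_ge0 (le_trans (ler_normB _ _))// lerD.
  + move=> s t /eqP -> /eqP; rewrite /idx => /eqP.
    by rewrite eqn_pmul2l// eqSS => /eqP.
Qed.

End Weights.
End Orthogonal.

(** * Horizontal semiconcavity of the squared distance *)

Section Perturbation.
Variables (R : realType) (m n2 : nat) (b : 'I_n2 -> 'M[R]_m).
Hypothesis hskew : skew_family b.

(** Summation by parts, moving the partial sums onto [f], where the weights can annihilate them. *)
Lemma pB_swap (h f : nat -> 'rV[R]_m) N :
  pB b h f N = Bform b (psum h N) (psum f N) - \sum_(i < N) Bform b (h i) (psum f i.+1).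
Proof.
elim: N => [|N IH]; first by rewrite /pB /psum !big_ord0 Bform0l subr0.
have S g : psum g N.+1 = psum g N + g N by rewrite /psum big_ord_recr.
rewrite /pB big_ord_recr [in RHS]big_ord_recr /= -/(pB b h f N) IH !S.
rewrite !BformDl !BformDr.
move: (\sum_(i < N) _) (Bform b _ _) (Bform b _ _) (Bform b _ _) (Bform b _ _).
by move=> X u v w x; apply/rowP => i; rewrite !mxE; ring.
Qed.

(* If psi kills the partial sums of f, shifting f by psi h compensates a
   translation of the starting point up to an error which is small when the
   steps of f are. *)
Lemma walk_perturbed p (f : nat -> 'rV[R]_m) (psi : nat -> R) (h : 'rV[R]_m) (s : R) N :
  \sum_(j < N) psi j = 1 -> \sum_(j < N) psi j *: psum f j = 0 ->
  walk b (gmul b p (s *: h, 0)) (mkseq (fun i => f i + (- s) *: (psi i *: h)) N) =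
  gmul b p (psum f N, pB b f f N + s *: Bform b h (\sum_(j < N) psi j *: f j)).
Proof.
move=> psi1 psi0.
pose eta i := psi i *: h.
have eta_sum : psum eta N = h by rewrite psum_scale psi1 scale1r.
have fe : pB b f eta N = 0.
  transitivity (Bform b (\sum_(j < N) psi j *: psum f j) h); last by rewrite psi0 Bform0l.
  rewrite Bform_suml; apply: eq_bigr => i _.
  by rewrite /eta BformZr BformZl.
have ef : pB b eta f N = Bform b h (psum f N) - Bform b h (\sum_(j < N) psi j *: f j).
  rewrite pB_swap eta_sum; congr (_ - _).
  (* Summation by parts yields the vertices after each step, the weights annihilate those before it:
     one step is left over, and this is the error. *)
  have -> : \sum_(j < N) psi j *: f j = \sum_(j < N) psi j *: psum f j.+1.
    transitivity (\sum_(j < N) psi j *: psum f j + \sum_(j < N) psi j *: f j).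
      by rewrite psi0 add0r.
    rewrite -big_split /=; apply: eq_bigr => j _.
    by rewrite -scalerDr /psum big_ord_recr.
  by rewrite Bform_sumr; apply: eq_bigr => j _; rewrite /eta BformZl BformZr.
rewrite walk_mkseq (pB_perturb b f eta) fe ef (pB_collinear hskew) scaler0 addr0 add0r.
have -> : psum (fun i => f i + - s *: eta i) N = psum f N - s *: h.
  by rewrite /psum big_split /= -scaler_sumr -/(psum eta N) eta_sum scaleNr.
rewrite -gmulA; congr gmul; rewrite /gmul /=; congr (_, _).
  by rewrite addrC subrK.
rewrite BformDr BformNr !BformZl !BformZr (Bformxx hskew h) !scaler0 subr0 add0r.
move: (Bform b h _) (Bform b h _) => u v.
by apply/rowP => i; rewrite !mxE; ring.
Qed.

End Perturbation.

Section Sums.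
Variable R : realType.

Lemma sqr_sum_le (N : nat) (F : 'I_N -> R) : (\sum_i F i) ^+ 2 <= N%:R * \sum_i F i ^+ 2.
Proof.
have e1 : enorm (const_mx 1 : 'rV[R]_N) ^+ 2 = N%:R.
  rewrite enorm_sqr /dot; under eq_bigr do rewrite !mxE mulr1.
  by rewrite sumr_const card_ord.
have e2 : enorm (\row_i F i) ^+ 2 = \sum_i F i ^+ 2.
  by rewrite enorm_sqr; apply: eq_bigr => i _; rewrite !mxE expr2.
have h := normr_dot (\row_i F i) (const_mx 1 : 'rV[R]_N).
have -> : \sum_i F i = dot (\row_i F i) (const_mx 1).
  by apply: eq_bigr => i _; rewrite !mxE mulr1.
rewrite -real_normK ?num_real// -e1 -e2 -exprMn mulrC.
by rewrite ler_pXn2r ?nnegrE ?mulr_ge0 ?enorm_ge0.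
Qed.

End Sums.

Section Semiconcavity.
Variables (R : realType) (n n2 : nat) (b : 'I_n2 -> 'M[R]_n.+1).
Hypothesis hskew : skew_family b.
Hypothesis hstep : step2_generating b.
Implicit Types (p q : pt R n.+1 n2) (h : 'rV[R]_n.+1).

Lemma perturbed_walks : exists2 C : R, 0 <= C & forall p q h (l e : R),
  ccdist b p q < l -> 0 < e -> exists s1 s2 : seq 'rV[R]_n.+1,
  [/\ wlen s1 ^+ 2 + wlen s2 ^+ 2 <= 2 * l ^+ 2 + C * enorm h ^+ 2 + e,
      (walk b (gmul b p (h, 0)) s1).1 = q.1,
      enorm (q.2 - (walk b (gmul b p (h, 0)) s1).2) <= e,
      (walk b (gmul b p (- h, 0)) s2).1 = q.1 &
      enorm (q.2 - (walk b (gmul b p (- h, 0)) s2).2) <= e].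
Proof.
have [C1 C10 hC1] := orthogonal_weights R n.
(* [N <= n.+3 * r] turns the bound [C1 / r] on the weights into [C2 / N]. *)
pose C2 := n.+3%:R * C1.
have C20 : 0 <= C2 by rewrite /C2 mulr_ge0.
exists (2 * C2 ^+ 2); first by rewrite mulr_ge0 ?exprn_ge0.
move=> p q h l e dl e0.
have [c c0 hc] := ccdist_chords hskew hstep p q.
have [cb cb0 hcb] := Bform_bounded b.
(* In units of [d] below, 1 accounts for the penalized gap and the other summand for the leftover
   term of the shift. *)
pose M := 1 + cb * enorm h * C2.
have M0 : 0 <= M by rewrite addr_ge0 ?mulr_ge0 ?enorm_ge0.
have l0 : 0 <= l by rewrite (le_trans (ccdist_ge0 b p q))// ltW.
pose J := l ^+ 2 + (c * l ^+ 2) ^+ 2.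
have J0 : 0 <= J by rewrite addr_ge0 ?exprn_ge0 ?mulr_ge0.
(* The two summands make [N] so large that twice the energy excess is at most [e] and that
   [M * d <= e]. *)
pose x := 2 * (c * l ^+ 2) ^+ 2 / e + M ^+ 2 * J / e ^+ 2.
pose r := (Num.truncn x).+1.
pose N := (n.+2 * r).+1.
have NR : 0 < N%:R :> R by rewrite ltr0n.
have rR : 0 < r%:R :> R by rewrite ltr0n.
have xr : x < r%:R by exact: truncnS_gt.
have rN : r%:R <= N%:R :> R by rewrite ler_nat /N mulSn ltnW// ltnS leq_addr.
have Nr : N%:R <= n.+3%:R * r%:R :> R.
  by rewrite -natrM ler_nat /N [leqRHS]mulSn -add1n leq_add2r.
have x1 : 2 * (c * l ^+ 2) ^+ 2 / N%:R <= e.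
  rewrite ler_pdivrMr// [leRHS]mulrC -ler_pdivrMr// (le_trans _ rN)//.
  by rewrite (le_trans _ (ltW xr))// /x lerDl divr_ge0 ?mulr_ge0 ?exprn_ge0// ltW.
have x2 : M ^+ 2 * (J / N%:R) <= e ^+ 2.
  rewrite mulrA ler_pdivrMr// [leRHS]mulrC -ler_pdivrMr ?exprn_gt0// (le_trans _ rN)//.
  rewrite (le_trans _ (ltW xr))// /x lerDr divr_ge0 ?mulr_ge0 ?exprn_ge0//.
  exact: ltW.
have [f0 [f0l f01 f02]] := hc l N dl isT.
pose z := gmul b (ginv p) q.
have qz : q = gmul b p z by rewrite gmulK.
rewrite walk_mkseq in f01 f02.
have f0z : psum f0 N = z.1 by move: f01; rewrite qz /= => /addrI.
have {}f02 : enorm (pB b f0 f0 N - z.2) <= c * l ^+ 2 / N%:R.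
  move: f02; rewrite {1}qz /= f0z; congr (enorm _ <= _).
  by move: (Bform b _ _) => y; apply/rowP => i; rewrite !mxE; ring.
(* The penalty weight [N] is large enough to force a gap [O(N^(-1/2))], and small enough for the
   chord polygon, with its gap [O(1/N)], to pay only [O(1/N)]. *)
have [f fz fmin] := cost_minimizer b N z.2 f0 (ltW NR).
have fJ : cost b N N%:R z.2 f <= l ^+ 2 + (c * l ^+ 2) ^+ 2 / N%:R.
  apply: (le_trans (fmin _ erefl)); rewrite /cost lerD//.
    apply: (@le_trans _ _ (N%:R * \sum_(i < N) (l / N%:R) ^+ 2)).
      rewrite ler_wpM2l ?(ltW NR)//; apply: ler_sum => i _.
      by rewrite ler_pXn2r ?nnegrE ?enorm_ge0 ?f0l ?divr_ge0// ltW.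
    rewrite sumr_const card_ord -[_ *+ N]mulr_natl le_eqVlt; apply/orP; left.
    by apply/eqP; field; rewrite gt_eqF.
  apply: (@le_trans _ _ (N%:R * (c * l ^+ 2 / N%:R) ^+ 2)).
    rewrite ler_wpM2l ?(ltW NR)// ler_pXn2r ?nnegrE ?enorm_ge0//.
    by rewrite divr_ge0 ?mulr_ge0 ?exprn_ge0// ltW.
  by rewrite le_eqVlt; apply/orP; left; apply/eqP; field; rewrite gt_eqF.
have S0 : 0 <= \sum_(i < N) enorm (f i) ^+ 2.
  by apply: sumr_ge0 => i _; rewrite exprn_ge0 ?enorm_ge0.
have fE : N%:R * \sum_(i < N) enorm (f i) ^+ 2 <= l ^+ 2 + (c * l ^+ 2) ^+ 2 / N%:R.
  by apply: le_trans fJ; rewrite /cost lerDl mulr_ge0 ?exprn_ge0 ?enorm_ge0 ?(ltW NR).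
have JN : l ^+ 2 + (c * l ^+ 2) ^+ 2 / N%:R <= J.
  rewrite lerD2l ler_pdivrMr// ler_peMr ?exprn_ge0 ?mulr_ge0 ?exprn_ge0//.
  by rewrite ler1n.
pose d := Num.sqrt (J / N%:R).
have d0 : 0 <= d by exact: sqrtr_ge0.
have dE : d ^+ 2 = J / N%:R by rewrite sqr_sqrtr// divr_ge0// ltW.
have leqd y : 0 <= y -> N%:R * y ^+ 2 <= J -> y <= d.
  move=> y0 yJ; rewrite -(@ler_pXn2r _ 2) ?nnegrE// dE ler_pdivlMr// mulrC.
  exact: yJ.
have fB : enorm (pB b f f N - z.2) <= d.
  apply: leqd; first exact: enorm_ge0.
  apply: le_trans JN; apply: le_trans fJ.
  by rewrite /cost lerDr mulr_ge0// ltW.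
have fd i : (i < N)%N -> enorm (f i) <= d.
  move=> iN; apply: leqd; first exact: enorm_ge0.
  apply: le_trans JN; apply: le_trans fE; rewrite ler_wpM2l ?(ltW NR)//.
  rewrite (bigD1 (Ordinal iN))//= lerDl; apply: sumr_ge0 => j _.
  by rewrite exprn_ge0 ?enorm_ge0.
have Md : M * d <= e.
  rewrite -(@ler_pXn2r _ 2) ?nnegrE ?mulr_ge0 ?(ltW e0)//.
  by rewrite exprMn dE.
have [A As Af] : exists2 A : 'M[R]_n.+1, A^T = - A & forall j, (j.+1 < N)%N ->
    f j.+1 *m (1%:M + A) = f j *m (1%:M - A).
  apply: (cost_critical hskew (ltn0Sn _)) => g gf.
  by apply: fmin; rewrite gf.
have hQ := cayley_orthogonal As; set Q := _ *m invmx _ in hQ.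
have fQ j : (j.+1 < N)%N -> f j.+1 = f j *m Q.
  move=> jN; rewrite /Q mulmxA -(Af j jN) mulmxK//.
  exact: skew_unitmx.
have [psi [psi1 psi0 psiC]] := hC1 f Q r hQ (ltn0Sn _) fQ.
rewrite -/N in psi1 psi0.
have psiN i : `|psi i| <= C2 / N%:R.
  apply: (le_trans (psiC i)); rewrite ler_pdivlMr// mulrAC ler_pdivrMr//.
  by rewrite /C2 mulrAC [leRHS]mulrC ler_wpM2l.
pose s (a : R) := mkseq (fun i => f i + (- a) *: (psi i *: h)) N.
have hs a : `|a| = 1 -> (walk b (gmul b p (a *: h, 0)) (s a)).1 = q.1 /\
    enorm (q.2 - (walk b (gmul b p (a *: h, 0)) (s a)).2) <= e.
  move=> a1; rewrite /s walk_perturbed// qz /= fz f0z; split=> //.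
  set y := \sum_(j < N) _.
  have yd : enorm y <= C2 * d.
    apply: (le_trans (ler_enorm_sum _ _ _)).
    apply: (@le_trans _ _ (\sum_(i < N) C2 / N%:R * d)).
      by apply: ler_sum => i _; rewrite enormZ ler_pM ?enorm_ge0 ?fd.
    by rewrite sumr_const card_ord -[_ *+ N]mulr_natl mulrA mulrCA mulfV ?mulr1// gt_eqF.
  have -> : p.2 + z.2 + Bform b p.1 z.1 -
      (p.2 + (pB b f f N + a *: Bform b h y) + Bform b p.1 z.1) =
      - (pB b f f N - z.2) - a *: Bform b h y.
    move: (Bform b _ _) (Bform b _ _) => u v.
    by apply/rowP => i; rewrite !mxE; ring.
  apply: le_trans Md; rewrite (le_trans (ler_enormD _ _))// !enormN enormZ a1 mul1r.
  rewrite /M mulrDl mul1r lerD// (le_trans (hcb _ _))//.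
  by rewrite mulrA -[leRHS]mulrA ler_wpM2l ?mulr_ge0 ?enorm_ge0.
have [h1 h2] := hs 1 (normr1 _); have [h3 h4] := hs (-1) (normrN1 _).
rewrite scale1r in h1 h2; rewrite scaleN1r in h3 h4.
exists (s 1), (s (-1)); split=> //.
rewrite /s !wlen_mkseq.
apply: le_trans (lerD (sqr_sum_le _) (sqr_sum_le _)) _.
rewrite -mulrDr -big_split /=.
have -> : \sum_(i < N) (enorm (f i + - 1 *: (psi i *: h)) ^+ 2 +
     enorm (f i + - -1 *: (psi i *: h)) ^+ 2) =
   2 * \sum_(i < N) enorm (f i) ^+ 2 + 2 * \sum_(i < N) psi i ^+ 2 * enorm h ^+ 2.
  rewrite !mulr_sumr -big_split /=; apply: eq_bigr => i _.
  rewrite scaleN1r opprK scale1r !enorm_sqrD enormN dotNr enormZ exprMn.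
  by rewrite real_normK ?num_real//; ring.
have psi2 : N%:R * \sum_(i < N) psi i ^+ 2 <= C2 ^+ 2.
  apply: (@le_trans _ _ (N%:R * \sum_(i < N) (C2 / N%:R) ^+ 2)).
    rewrite ler_wpM2l ?(ltW NR)//; apply: ler_sum => i _.
    by rewrite -real_normK ?num_real// ler_pXn2r ?nnegrE ?divr_ge0// ltW.
  rewrite sumr_const card_ord -[_ *+ N]mulr_natl le_eqVlt; apply/orP; left.
  by apply/eqP; field; rewrite gt_eqF.
rewrite -mulr_suml mulrDr mulrCA.
have {}psi2 := ler_wpM2r (exprn_ge0 2 (enorm_ge0 h)) psi2.
move: x1 psi2 fE; rewrite -!mulrA.
move: (\sum_(i < N) _) (\sum_(i < N) _) (enorm h) => u v w.
move: (_ / N%:R) => y; move: (N%:R) => k.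
rewrite !mulrA.
lra.
Qed.

End Semiconcavity.

Section SquaredDistance.
Variable R : realType.

Lemma le_of_le_perturbed (S X d D K : R) : 0 <= d -> 0 <= D -> 0 <= K ->
  (forall t, 0 < t -> t <= 1 ->
    S <= 2 * (d + t) ^+ 2 + X + t ^+ 2 + 2 * (K * t) * D) ->
  S <= 2 * d ^+ 2 + X.
Proof.
move=> d0 D0 K0 h; apply/ler_addgt0Pr => e e0.
(* The coefficients of [t], once [t^2 <= t] is used. *)
pose c := 3 + 4 * d + 2 * K * D.
have c0 : 0 < c by rewrite /c -addrA ltr_wpDr// addr_ge0 ?mulr_ge0.
pose t := Num.min 1 (e / c).
have t0 : 0 < t by rewrite lt_min ltr01 divr_gt0.
have t1 : t <= 1 by rewrite ge_min lexx.
have tc : t * c <= e by rewrite -ler_pdivlMr// ge_min lexx orbT.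
have := h t t0 t1; have := ler_wpM2l (ltW t0) t1; rewrite mulr1 => tt.
move: tc; rewrite /c => tc hS.
apply: (le_trans hS).
have -> : 2 * (d + t) ^+ 2 + X + t ^+ 2 + 2 * (K * t) * D =
  2 * d ^+ 2 + X + (3 * (t * t) + t * (4 * d + 2 * K * D)) by ring.
rewrite lerD2l; apply: le_trans tc.
have -> : t * (3 + 4 * d + 2 * K * D) = 3 * t + t * (4 * d + 2 * K * D) by ring.
by rewrite lerD2r; lra.
Qed.

(** For [x >= a] this is [(x - a)^2 <= L^2]. The error is measured by [x], a distance given
    beforehand, and not by [L], which varies with the perturbation. *)
Lemma sqr_le_shifted (x L a : R) : 0 <= x -> 0 <= L -> 0 <= a -> x <= L + a ->
  x ^+ 2 <= L ^+ 2 + 2 * a * x.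
Proof.
move=> x0 L0 a0 xLa; have [xa|ax] := leP x a.
  have := ler_wpM2r x0 xa; have := sqr_ge0 L; have := mulr_ge0 a0 x0; nra.
have h : (x - a) ^+ 2 <= L ^+ 2 by rewrite ler_pXn2r ?nnegrE ?subr_ge0 ?(ltW ax)// lerBlDr.
by have := sqr_ge0 a; nra.
Qed.

(** Allows [m] to be written [n.+1], so that square matrices form a nonzero ring with powers
    [Q ^+ k]. *)
Lemma step2_dim_gt0 (m n2 : nat) (b : 'I_n2 -> 'M[R]_m) :
  step2_generating b -> (0 < m)%N.
Proof.
move=> [n20 h]; case: (posnP m) => // m0.
have [c hc] := h (delta_mx 0 (Ordinal n20)).
have := congr1 (fun v : 'rV[R]_n2 => v 0 (Ordinal n20)) hc.
rewrite mxE !eqxx big1 ?mxE => [/eqP|i _]; first by rewrite oner_eq0.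
by move: (ltn_ord i); rewrite [X in (_ < X)%N]m0.
Qed.

End SquaredDistance.

Lemma ccdist_sqr_semiconcave (R : realType) (m n2 : nat) (b : 'I_n2 -> 'M[R]_m) :
  skew_family b -> step2_generating b -> exists2 C : R, 0 <= C &
  forall (p q : pt R m n2) (h : 'rV[R]_m),
  ccdist b (gmul b p (h, 0)) q ^+ 2 + ccdist b (gmul b p (- h, 0)) q ^+ 2 <=
  2 * ccdist b p q ^+ 2 + C * enorm h ^+ 2.
Proof.
move=> hskew hstep; have := step2_dim_gt0 hstep.
case: m b hskew hstep => // n b hskew hstep _.
have [C C0 hC] := perturbed_walks hskew hstep; exists C => // p q h.
have [K K0 hK] := ccdist_central hskew hstep.
pose p1 := gmul b p (h, 0); pose p2 := gmul b p (- h, 0).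
have d0 := ccdist_ge0 b p q; have x0 := ccdist_ge0 b p1 q; have y0 := ccdist_ge0 b p2 q.
apply: (le_of_le_perturbed d0 (addr_ge0 x0 y0) K0) => t t0 t1.
have dl : ccdist b p q < ccdist b p q + t by rewrite ltrDl.
(* The tolerance is [t ^+ 2] because closing a central gap costs its square root. *)
have [s1 [s2 [hs e1 f1 e2 f2]]] := hC p q h _ _ dl (exprn_gt0 2 t0).
have bound p' s : (walk b p' s).1 = q.1 -> enorm (q.2 - (walk b p' s).2) <= t ^+ 2 ->
    ccdist b p' q <= wlen s + K * t.
  move=> e f; have := ccdist_triangle hskew hstep (walk b p' s) p' q.
  move=> /le_trans; apply; apply: lerD; first exact: ccdist_walk.
  apply: le_trans (hK _ _ e) _; apply: ler_wpM2l => //.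
  by rewrite -[leRHS](ger0_norm (ltW t0)) -sqrtr_sqr ler_wsqrtr.
have h1 := bound _ _ e1 f1; have h2 := bound _ _ e2 f2.
have Kt : 0 <= K * t by rewrite mulr_ge0// ltW.
have {}h1 := sqr_le_shifted x0 (wlen_ge0 s1) Kt h1.
have {}h2 := sqr_le_shifted y0 (wlen_ge0 s2) Kt h2.
move: h1 h2 hs {hK hC dl bound e1 f1 e2 f2 x0 y0 d0}; rewrite -/p1 -/p2.
move: (ccdist b p1 q) (ccdist b p2 q) (ccdist b p q) (wlen s1) (wlen s2) (enorm h).
by move=> x y d L1 L2 H h1 h2 h3; nra.
Qed.

(** * The Hopf-Lax formula *)

Section InfConvolution.
Variables (R : realType) (T : Type) (d : T -> T -> R) (g : T -> R) (o : T) (C t : R).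
Hypothesis d_ge0 : forall p q, 0 <= d p q.
Hypothesis d_sym : forall p q, d p q = d q p.
Hypothesis d_tri : forall q p r, d p r <= d p q + d q r.
Hypothesis C0 : 0 < C.
Hypothesis g_growth : forall p, - C * (1 + d p o) <= g p.
Hypothesis t0 : 0 < t.

Definition infconv p := inf [set g q + d p q ^+ 2 / (2 * t) | q in [set: T]].

Lemma infconv_coercive p q :
  - (C * (1 + d p o)) - C * d p q + d p q ^+ 2 / (2 * t) <= g q + d p q ^+ 2 / (2 * t).
Proof.
rewrite lerD2r; apply: le_trans (g_growth q).
have := ler_wpM2l (ltW C0) (d_tri p q o); rewrite (d_sym q p).
by move: (d p q) (d p o) (d q o) => x y z; lra.
Qed.

Lemma quadratic_lower_bound (a s : R) :
  - (a ^+ 2 * t / 2) <= s ^+ 2 / (2 * t) - a * s.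
Proof.
rewrite -subr_ge0.
have -> : s ^+ 2 / (2 * t) - a * s - - (a ^+ 2 * t / 2) = (s - a * t) ^+ 2 / (2 * t).
  by field; rewrite gt_eqF.
by rewrite divr_ge0 ?sqr_ge0// mulr_ge0// ltW.
Qed.

Lemma infconv_has_inf p : has_inf [set g q + d p q ^+ 2 / (2 * t) | q in [set: T]].
Proof.
split; first by exists (g p + d p p ^+ 2 / (2 * t)); exists p.
exists (- (C * (1 + d p o)) - C ^+ 2 * t / 2) => _ [q _ <-].
apply: le_trans (infconv_coercive p q).
have := quadratic_lower_bound C (d p q).
by move: (d p q ^+ 2 / _) (C * d p q) (C * (1 + _)) => x y z; lra.
Qed.

Lemma infconv_le p q : infconv p <= g q + d p q ^+ 2 / (2 * t).
Proof. by apply: ge_inf; [exact: (infconv_has_inf p).2|exists q]. Qed.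

Lemma infconv_ge p c : (forall q, c <= g q + d p q ^+ 2 / (2 * t)) -> c <= infconv p.
Proof.
move=> h; apply: lb_le_inf; first exact: (infconv_has_inf p).1.
by move=> _ [q _ <-].
Qed.

(** Every competitor [q] at [p] also competes at [p1] and [p2], so no minimizer has to exist. *)
Lemma infconv_semiconcave p p1 p2 X :
  (forall q, d p1 q ^+ 2 + d p2 q ^+ 2 <= 2 * d p q ^+ 2 + X) ->
  infconv p1 + infconv p2 - 2 * infconv p <= X / (2 * t).
Proof.
move=> h; have t2 : 0 < (2 * t)^-1 by rewrite invr_gt0 mulr_gt0.
suff : (infconv p1 + infconv p2 - X / (2 * t)) / 2 <= infconv p.
  by move: (infconv p) (infconv p1) (infconv p2) (X / _) => x y z w; lra.
apply: infconv_ge => q.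
have := infconv_le p1 q; have := infconv_le p2 q.
have := ler_wpM2r (ltW t2) (h q); rewrite !(mulrDl _ _ (2 * t)^-1).
move: (infconv p1) (infconv p2) (2 * t)^-1 (d p1 q) (d p2 q) (d p q) (g q).
by move=> u v i x y z k; lra.
Qed.

(* A convex combination with weight r of the trivial bound and of the coercive
   bound absorbs the loss d(p,q) r / t, uniformly in q. *)
Lemma infconv_lower p : exists M : R, forall p' r, d p' p <= r -> 0 <= r -> r <= 1 ->
  infconv p - r * M <= infconv p'.
Proof.
(* The slope [C] in [a] absorbs the linear loss of the coercive bound; the extra [t^-1] leaves a
   bound on [s / t] in terms of [v]. *)
pose A := C * (1 + d p o); pose a := C + t^-1.
exists (infconv p + A + a ^+ 2 * t / 2) => p' r pr r0 r1.
apply: infconv_ge => q.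
set s := d p q; set s' := d p' q; set v := g q + s ^+ 2 / (2 * t).
have hs : s <= s' + r.
  by have := d_tri p' p q; rewrite (d_sym p p') -/s -/s'; lra.
have s0 : 0 <= s by exact: d_ge0.
have s'0 : 0 <= s' by exact: d_ge0.
have h1 : s ^+ 2 <= s' ^+ 2 + 2 * r * s by exact: sqr_le_shifted.
have h2 : infconv p <= v by exact: infconv_le.
have h3 : - A - C * s + s ^+ 2 / (2 * t) <= v by exact: infconv_coercive.
have h4 := quadratic_lower_bound a s.
have t2 : 0 <= (2 * t)^-1 by rewrite invr_ge0 mulr_ge0// ltW.
have {}h1 := ler_wpM2r t2 h1.
have e : (s' ^+ 2 + 2 * r * s) / (2 * t) = s' ^+ 2 / (2 * t) + r * (s / t).
  by field; rewrite gt_eqF.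
rewrite e in h1.
have {}h4 : - A - (a ^+ 2 * t / 2) <= v - s / t.
  have e2 : a * s = C * s + s / t by rewrite /a mulrDl [_^-1 * _]mulrC.
  by rewrite e2 in h4; lra.
have h5 := ler_wpM2l r0 h4.
have h6 : (1 - r) * infconv p <= (1 - r) * v by rewrite ler_wpM2l// subr_ge0.
have h7 : v <= g q + (s' ^+ 2 / (2 * t) + r * (s / t)) by rewrite /v lerD2l.
move: h5 h6 h7; clear.
move: (a ^+ 2 * t / 2) (s' ^+ 2 / (2 * t)) (s / t) (infconv p) (g q) A v.
by move=> B w c u k A v; lra.
Qed.

End InfConvolution.

Theorem theorem6p2 (R : realType) (m n2 : nat) (b : 'I_n2 -> 'M[R]_m)
  (hskew : skew_family b) (hstep : step2_generating b)
  (g : pt R m n2 -> R) (hg : lsc g) (C : R) (hC : 0 < C)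
  (hgrowth : forall p, - C * (1 + ccdist b p (0, 0)) <= g p) :
  forall t : R, 0 < t -> hsemiconcave b (hopf_lax b g t).
Proof.
move=> t t0.
have dC := ccdistC hskew hstep.
have dT := ccdist_triangle hskew hstep.
have uE p : hopf_lax b g t p = infconv (ccdist b) g t p by [].
split.
- move=> p e e0.
  have [M hM] := infconv_lower (ccdist_ge0 b) dC dT hC hgrowth t0 p.
  (* The bound from [infconv_lower] needs [r <= 1]; the other term makes the loss [r * M] at most
     [e / 2]. *)
  pose r := Num.min 1 (e / 2 / (`|M| + 1)).
  have M0 : 0 < `|M| + 1 by rewrite ltr_wpDl.
  have r0 : 0 < r by rewrite lt_min ltr01 !divr_gt0.
  have r1 : r <= 1 by rewrite ge_min lexx.
  have [delta delta0 hd] := ccdist_euclidean hskew hstep p r0.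
  exists delta => // q /hd /ltW pq.
  have := hM q r pq (ltW r0) r1; rewrite !uE.
  have : r * M < e.
    apply: (@le_lt_trans _ _ (r * (`|M| + 1))).
      rewrite ler_wpM2l ?(ltW r0)// (le_trans (ler_norm M))// lerDl.
      exact: ler01.
    apply: (@le_lt_trans _ _ (e / 2)); last by rewrite ltr_pdivrMr// ltr_pMr// ltr1n.
    by rewrite -ler_pdivlMr// ge_min lexx orbT.
  by move: (infconv _ _ _ p) (infconv _ _ _ q) (r * M) => x y z; lra.
- have [K K0 hK] := ccdist_sqr_semiconcave hskew hstep.
  exists (K / (2 * t)); split; first by rewrite divr_ge0 ?mulr_ge0 ?(ltW t0).
  move=> p h1 /=; rewrite !uE /ginv /= oppr0 mulrAC.
  apply: (infconv_semiconcave dC dT hC hgrowth t0) => q.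
  exact: hK.
Qed.
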